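(* Let $Q_n$ be the network for the pentagram map (with non-commutative weights $X_i,Y_i,Z$), let $\mathscr{B}=\mathscr{B}(\lambda)$ be its boundary measurement matrix, and write $\mathrm{tr}(\mathscr{B}^i)=\sum_k t_{ik}\lambda^k$ for $i\ge 1$. Then for all $i,j,k,\ell$, $$\left\langle t_{ik},t_{j\ell}\right\rangle=0 ,$$ where $\langle-,-\rangle$ is the bracket modulo commutators induced by the double bracket of the network.
   Context: Double brackets. A double bracket on an associative algebra $A$ over a field $\mathbb{K}$ is a $\mathbb{K}$-bilinear map $\{\!\{-,-\}\!\}:A\times A\to A\otimes A$ with $\{\!\{a,bc\}\!\}=\{\!\{a,b\}\!\}(1\otimes c)+(b\otimes 1)\{\!\{a,c\}\!\}$ and $\{\!\{b,a\}\!\}=-\{\!\{a,b\}\!\}^\tau$, where $(x\otimes y)^\tau=y\otimes x$. Put $\{a,b\}=\mu(\{\!\{a,b\}\!\})$ with $\mu$ the multiplication. With $A^\natural=A/[A,A]$ the quotient by the linear span of all commutators (class of $a$ denoted $a^\natural$), the induced bracket $\langle a^\natural,b^\natural\rangle:=\{a,b\}^\natural$ is a well-defined skew-symmetric bilinear map on $A^\natural$; one writes $\langle a,b\rangle$ for $\langle a^\natural,b^\natural\rangle$. The algebra. Let $\mathcal{F}$ be the free skew field over $\mathbb{Q}$ (universal field of fractions of the free associative algebra) on $a_i,b_i,c_i,d_i$, $1\le i\le n$, with the double bracket determined by $\{\!\{b_i,a_i\}\!\}=\tfrac12\, b_i\otimes a_i$, $\{\!\{b_i,c_i\}\!\}=\tfrac12\,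 c_i\otimes b_i$, $\{\!\{a_i,d_i\}\!\}=\tfrac12\, 1\otimes a_id_i$, $\{\!\{c_i,d_i\}\!\}=\tfrac12\, d_ic_i\otimes 1$, all other double brackets of generators not following from these by skew-symmetry being $0$. (These are the weights of the left, bottom, right and top edges of the $i$-th square face of the network when all other edges have weight $1$.) Put $z_k=d_1c_1\cdots d_{k-1}c_{k-1}d_k$ for $1\le k\le n$, $Z=z_nc_n$, $z_0=Z^{-1}z_n$, $z_{-1}=Z^{-1}z_{n-1}$, and, with indices of $a,b,c,d$ read mod $n$, $$X_i=z_{i-2}\,a_ic_{i-1}^{-1}d_{i-1}^{-1}c_{i-2}^{-1}\,z_{i-2}^{-1},\qquad Y_i=z_{i-2}\,b_ic_i^{-1}d_i^{-1}c_{i-1}^{-1}d_{i-1}^{-1}c_{i-2}^{-1}\,z_{i-2}^{-1}\qquad(1\le i\le n).$$ These are the weights obtained from $a,b,c,d$ by gauge transformations (multiplying the weights of all arrows entering a vertex by some $t$ on the right and of all arrows leaving it by $t^{-1}$ on the left). $\mathscr{L}_\bullet\subset\mathcal{F}$ is the subalgebra generated by the $X_i,Y_i,Z$ and their inverses; it is closed under the double bracket, and the $t_{ik}$ lie in it. The network $Q_n$. It has $n$ square faces; face $i$ has vertices $tl_i,tr_i,bl_i,br_i$ (top-left, top-right, bottom-left, bottom-right) and arrows $bl_i\to tl_i$ of weight $X_i$, $bl_i\to br_i$ of weight $Y_i$, $tl_i\to tr_i$ and $tr_i\to br_i$ of weight $1$. There are further arrows $br_i\to tl_{i+1}$ and $tr_i\to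 bl_{i+2}$ of weight $1$ whenever both faces have index at most $n$. Sources $1,2,3$ on one boundary circle of a cylinder have arrows of weight $1$ to $tl_1,bl_1,bl_2$ respectively; sinks $1,2,3$ on the other boundary circle receive arrows of weight $Z$ from $br_n,tr_{n-1},tr_n$ respectively. Gluing source $s$ to sink $s$ gives a network on a torus; the common boundary circle is the rim. The cut. The cylinder is drawn as a rectangle with top and bottom edges identified, sources on the left side and sinks on the right side; the cut is the identified top/bottom edge, oriented from left to right. In the drawing the faces are placed from left to right on three horizontal strands, each face one strand lower than the previous one; for each face $i$ with $i$ divisible by $3$, the arrow $br_{i-1}\to tl_i$ leaves through the bottom edge and re-enters from the top edge, and the arrow leaving $tr_i$ towards $bl_{i+2}$ (or towards the corresponding sink) leaves through the top edge and re-enters from the bottom edge; no other arrow meets the cut. The variable $\lambda$ commutes with everything; an arrow crossing the cut downward has its weight multiplied by $\lambda$, an arrow crossing it upward by $\lambda^{-1}$. The $(s,t)$ entry of $\mathscr{B}(\lambda)$ is the sum over all directed paths from source $s$ to sink $t$ of the product, from left to right, of these modified edge weights; entries lie in $\mathscr{L}_\bullet[\lambda^{\pm1}]$. Thus $t_{ik}$ is the sum of the closed directed paths on the torus network which cross the rim $i$ times and the cut $k$ times (with sign).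
   Formalization: When 3 does not divide n, the right boundary circle is turned by one strand so that the cut closes up on the torus: tr_n→sink 3 gets an extra factor λ^{-1} if n≡1 mod 3, and br_n→sink 1 a factor λ if n≡2 mod 3 (as literally described the claim fails, e.g. n=4); n≥2 is assumed. *)

(* Defs.v *)
From HB Require Import structures.
From mathcomp Require Import all_boot all_order all_algebra.
From mathcomp Require Import generic_quotient ring_quotient.
From mathcomp Require Import boolp.
From mathcomp Require Import finmap monalg zify.

Set Implicit Arguments.
Unset Strict Implicit.
Unset Printing Implicit Defensive.

Import GRing.Theory.
Local Open Scope ring_scope.
Local Open Scope quotient_scope.

Notation bilinear_map f := (bilinear_for *:%R *:%R f).

(* An element of [tensor U V] is a class of finite formal sums of pairs; two
   sums are identified when every bilinear map takes the same value on them. *)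
Section Tensor.
Variables (K : fieldType) (U V : lmodType K).

Definition tensor_eq (s t : seq (U * V)) : bool :=
  `[< forall (W : lmodType K) (f : U -> V -> W), bilinear_map f ->
        \sum_(p <- s) f p.1 p.2 = \sum_(p <- t) f p.1 p.2 >].

Lemma tensor_eq_refl : reflexive tensor_eq.
Proof. by move=> s; apply/asboolP. Qed.

Lemma tensor_eq_sym : symmetric tensor_eq.
Proof.
by move=> s t; apply/asboolP/asboolP => H W f fb; rewrite (H W f fb).
Qed.

Lemma tensor_eq_trans : transitive tensor_eq.
Proof.
move=> s t u /asboolP H1 /asboolP H2; apply/asboolP => W f fb.
by rewrite (H1 W f fb) (H2 W f fb).
Qed.

Canonical tensor_eq_equiv :=
  EquivRel tensor_eq tensor_eq_refl tensor_eq_sym tensor_eq_trans.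

Definition tensor := {eq_quot tensor_eq}.
HB.instance Definition _ := Choice.on tensor.
HB.instance Definition _ := EqQuotient.on tensor.

Definition tens (x : U) (y : V) : tensor := \pi_tensor [:: (x, y)].

(* The linear map induced by a bilinear map [f]. *)
Definition tensor_lift (W : zmodType) (f : U -> V -> W) (t : tensor) : W :=
  \sum_(p <- repr t) f p.1 p.2.

Section Lift.
Variables (W : lmodType K) (f : U -> V -> W).
Hypothesis fb : bilinear_map f.

Lemma tensor_lift_pi s :
  tensor_lift f (\pi s : tensor) = \sum_(p <- s) f p.1 p.2.
Proof.
have /eqmodP/asboolP := reprK (\pi_tensor s).
by move=> /(_ W f fb).
Qed.

Lemma tensor_lift_tens x y : tensor_lift f (tens x y) = f x y.
Proof. by rewrite tensor_lift_pi big_seq1. Qed.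

End Lift.

Lemma tensorP (a b : tensor) :
  (forall (W : lmodType K) (f : U -> V -> W), bilinear_map f ->
     tensor_lift f a = tensor_lift f b) -> a = b.
Proof.
move=> H; rewrite -(reprK a) -(reprK b); apply/eqmodP/asboolP => W f fb.
exact: H.
Qed.

Definition tensor_zero : tensor := \pi_tensor [::].
Definition tensor_add (a b : tensor) : tensor := \pi_tensor (repr a ++ repr b).
Definition tensor_scale (k : K) (a : tensor) : tensor :=
  \pi_tensor [seq (k *: p.1, p.2) | p <- repr a].
Definition tensor_opp (a : tensor) : tensor :=
  \pi_tensor [seq (- p.1, p.2) | p <- repr a].

Section LiftOps.
Variables (W : lmodType K) (f : U -> V -> W).
Hypothesis fb : bilinear_map f.

Lemma tensor_lift_zero : tensor_lift f tensor_zero = 0.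
Proof. by rewrite tensor_lift_pi // big_nil. Qed.

Lemma tensor_lift_add a b :
  tensor_lift f (tensor_add a b) = tensor_lift f a + tensor_lift f b.
Proof. by rewrite tensor_lift_pi // big_cat. Qed.

Lemma tensor_lift_scale k a :
  tensor_lift f (tensor_scale k a) = k *: tensor_lift f a.
Proof.
rewrite tensor_lift_pi // big_map scaler_sumr; apply: eq_bigr => p _ /=.
exact: (scalable_linear (fb.1 p.2)).
Qed.

Lemma tensor_lift_opp a : tensor_lift f (tensor_opp a) = - tensor_lift f a.
Proof.
rewrite tensor_lift_pi // big_map -sumrN; apply: eq_bigr => p _ /=.
by have /= := scalable_linear (fb.1 p.2) (-1) p.1; rewrite !scaleN1r.
Qed.

End LiftOps.

Definition tensor_liftE :=
  (tensor_lift_zero, tensor_lift_add, tensor_lift_scale, tensor_lift_opp).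

Lemma tensor_addA : associative tensor_add.
Proof. by move=> a b c; apply: tensorP => W f fb; rewrite !tensor_liftE ?addrA. Qed.
Lemma tensor_addC : commutative tensor_add.
Proof. by move=> a b; apply: tensorP => W f fb; rewrite !tensor_liftE // addrC. Qed.
Lemma tensor_add0 : left_id tensor_zero tensor_add.
Proof. by move=> a; apply: tensorP => W f fb; rewrite !tensor_liftE // add0r. Qed.
Lemma tensor_addN : left_inverse tensor_zero tensor_opp tensor_add.
Proof. by move=> a; apply: tensorP => W f fb; rewrite !tensor_liftE // addNr. Qed.
HB.instance Definition _ :=
  GRing.isZmodule.Build tensor tensor_addA tensor_addC tensor_add0 tensor_addN.

Lemma tensor_scaleA a b t :
  tensor_scale a (tensor_scale b t) = tensor_scale (a * b) t.
Proof. by apply: tensorP => W f fb; rewrite !tensor_liftE // scalerA. Qed.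
Lemma tensor_scale1 : left_id 1 tensor_scale.
Proof. by move=> a; apply: tensorP => W f fb; rewrite !tensor_liftE // scale1r. Qed.
Lemma tensor_scaleDr : right_distributive tensor_scale +%R.
Proof.
move=> k a b; apply: tensorP => W f fb.
by rewrite -![_ + _]/(tensor_add _ _) !tensor_liftE // scalerDr.
Qed.
Lemma tensor_scaleDl t : {morph tensor_scale^~ t : a b / a + b}.
Proof.
move=> a b; apply: tensorP => W f fb.
by rewrite -[RHS in _ = RHS]/(tensor_lift f (tensor_add _ _)) !tensor_liftE // scalerDl.
Qed.
HB.instance Definition _ := GRing.Zmodule_isLmodule.Build K tensor
  tensor_scaleA tensor_scale1 tensor_scaleDr tensor_scaleDl.

Lemma tensor_lift_linear (W : lmodType K) (f : U -> V -> W) :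
  bilinear_map f -> linear (tensor_lift f).
Proof.
move=> fb k a b; rewrite -[_ + _ in LHS]/(tensor_add (tensor_scale k a) b).
by rewrite !tensor_liftE.
Qed.

Lemma tens_bilinear : bilinear_map tens.
Proof.
split=> [y k x x'|x k y y']; apply: tensorP => W f fb;
  rewrite (tensor_lift_linear fb) !tensor_lift_tens //.
- exact: (fb.1 y).
- exact: (fb.2 x).
Qed.

End Tensor.

Notation "x \ox y" := (tens x y) (at level 40, left associativity) : ring_scope.

Definition tensor_flip (K : fieldType) (U V : lmodType K) :
  tensor U V -> tensor V U := tensor_lift (fun x y => y \ox x).

Section TensorAlgebra.
Variables (K : fieldType) (A B : algType K).
Implicit Types a b c : tensor A B.

Definition tensor_one : tensor A B := 1 \ox 1.
Definition tensor_mul a b : tensor A B :=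
  \pi_(tensor A B) [seq (p.1 * q.1, p.2 * q.2) | p <- repr a, q <- repr b].

Lemma mul_bilinear (W : lmodType K) (f : A -> B -> W) x y :
  bilinear_map f -> bilinear_map (fun u v => f (x * u) (y * v)).
Proof.
move=> fb; split=> [v k u u'|u k v v'].
- by rewrite mulrDr -scalerAr (fb.1 (y * v)).
- by rewrite mulrDr -scalerAr (fb.2 (x * u)).
Qed.

Lemma lift_bilinear (W : lmodType K) (f : A -> B -> W) b :
  bilinear_map f ->
  bilinear_map (fun x y => tensor_lift (fun u v => f (x * u) (y * v)) b).
Proof.
move=> fb; split=> [y k x x'|x k y y'] /=;
  rewrite /tensor_lift scaler_sumr -big_split; apply: eq_bigr => p _ /=.
- by rewrite mulrDl -scalerAl (fb.1 (y * p.2)).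
- by rewrite mulrDl -scalerAl (fb.2 (x * p.1)).
Qed.

Lemma tensor_lift_mul (W : lmodType K) (f : A -> B -> W) a b :
  bilinear_map f -> tensor_lift f (tensor_mul a b) =
    tensor_lift (fun x y => tensor_lift (fun u v => f (x * u) (y * v)) b) a.
Proof. by move=> fb; rewrite tensor_lift_pi // big_allpairs_dep. Qed.

Lemma eq_tensor_lift (W : zmodType) (f g : A -> B -> W) a :
  (forall x y, f x y = g x y) -> tensor_lift f a = tensor_lift g a.
Proof. by move=> fg; apply: eq_bigr => p _. Qed.

Lemma tensor_mulA : associative tensor_mul.
Proof.
move=> a b c; apply: tensorP => W f fb.
rewrite !tensor_lift_mul //; last exact: lift_bilinear.
apply: eq_tensor_lift => x y.
rewrite tensor_lift_mul; last exact: mul_bilinear.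
by do 2![apply: eq_tensor_lift => ? ?]; rewrite !mulrA.
Qed.

Lemma tensor_mul1l : left_id tensor_one tensor_mul.
Proof.
move=> a; apply: tensorP => W f fb; rewrite tensor_lift_mul //.
rewrite tensor_lift_tens; last exact: lift_bilinear.
by apply: eq_tensor_lift => x y; rewrite !mul1r.
Qed.

Lemma tensor_mul1r : right_id tensor_one tensor_mul.
Proof.
move=> a; apply: tensorP => W f fb; rewrite tensor_lift_mul //.
apply: eq_tensor_lift => x y.
by rewrite tensor_lift_tens ?mulr1 //; apply: mul_bilinear.
Qed.

Lemma tensor_mulDl : left_distributive tensor_mul +%R.
Proof.
move=> a b c; apply: tensorP => W f fb.
rewrite tensor_lift_mul // -![_ + _]/(tensor_add _ _).
rewrite (tensor_lift_add (lift_bilinear c fb)).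
by rewrite tensor_lift_add // !tensor_lift_mul.
Qed.

Lemma tensor_mulDr : right_distributive tensor_mul +%R.
Proof.
move=> a b c; apply: tensorP => W f fb.
rewrite tensor_lift_mul // -![_ + _]/(tensor_add _ _) !tensor_lift_add //.
rewrite !tensor_lift_mul // -big_split; apply: eq_bigr => p _ /=.
by rewrite tensor_lift_add //; apply: mul_bilinear.
Qed.

HB.instance Definition _ := GRing.Zmodule_isPzRing.Build (tensor A B)
  tensor_mulA tensor_mul1l tensor_mul1r tensor_mulDl tensor_mulDr.

Lemma tens_mul (x x' : A) (y y' : B) :
  (x \ox y) * (x' \ox y') = (x * x') \ox (y * y').
Proof.
apply: tensorP => W f fb; rewrite -[_ * _]/(tensor_mul _ _) tensor_lift_mul //.
rewrite (tensor_lift_tens (lift_bilinear _ fb)).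
by rewrite (tensor_lift_tens (mul_bilinear _ _ fb)) tensor_lift_tens.
Qed.

End TensorAlgebra.

Definition tensor_mult (K : fieldType) (A : algType K) :
  tensor A A -> A := tensor_lift *%R.

Record double_bracket (K : fieldType) (A : algType K)
    (db : A -> A -> tensor A A) : Prop := DoubleBracket {
  db_bilinear : bilinear_map db;
  db_leibniz : forall a b c : A,
    db a (b * c) = db a b * (1 \ox c) + (b \ox 1) * db a c;
  db_skew : forall a b : A, db b a = - tensor_flip (db a b)
}.

Section ModCommutators.
Variables (K : fieldType) (A : algType K).

Definition generated_subalgebra (G : A -> Prop) : {pred A} :=
  fun z => `[< forall S : {pred A}, subalg_closed S ->
                 (forall x, G x -> x \in S) -> z \in S >].

Definition commutator_space (L : {pred A}) : {pred A} :=
  fun z => `[< forall S : {pred A}, submod_closed S ->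
                 {in L &, forall x y, x * y - y * x \in S} -> z \in S >].

Lemma commutator_space_zmod_closed L : zmod_closed (commutator_space L).
Proof.
split=> [|x y /asboolP Hx /asboolP Hy]; apply/asboolP => S subS commS.
  by case: subS.
have [_ linS] := subS.
by rewrite addrC -scaleN1r; apply: linS; [apply: Hy | apply: Hx].
Qed.

HB.instance Definition _ L := GRing.isZmodClosed.Build A (commutator_space L)
  (commutator_space_zmod_closed L).

(* For a subalgebra [L] of [A], the space L/[L,L] is the image of [L] in the
   quotient A/[L,L] below, so that a class which vanishes here vanishes in
   L/[L,L]. *)
Definition natural (L : {pred A}) : zmodType :=
  Quotient.quot (commutator_space L : zmodClosed A).

(* <x,y>, in terms of representatives; for x and y in a subalgebra L closed
   under the double bracket it is a class of L/[L,L]. *)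
Definition natural_bracket (db : A -> A -> tensor A A) (L : {pred A})
  (x y : A) : natural L := \pi_(natural L) (tensor_mult (db x y)).

End ModCommutators.

Definition division_ring (D : unitRingType) : Prop :=
  forall x : D, x != 0 -> x \is a GRing.unit.

(* Cohn's notions: an epic R-field is a skew field generated, as a skew field,
   by the image of R; a specialization is a morphism of R-rings defined on a
   subring, outside the kernel of which every element is invertible (such a
   subring is local); the universal R-field specializes to every epic
   R-field. *)
Section UniversalField.
Variable R : nzRingType.

Definition epic_field (D : unitRingType) (psi : R -> D) : Prop :=
  division_ring D /\
  forall S : {pred D}, divring_closed S -> (forall r, psi r \in S) ->
    forall x, x \in S.

Definition specializes_to (U D : unitRingType) (phi : R -> U) (psi : R -> D) :
  Prop :=
  exists (S : {pred U}) (f : U -> D),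
    [/\ subring_closed S,
        {in S &, {morph f : x y / x - y}},
        {in S &, {morph f : x y / x * y}},
        forall r, phi r \in S /\ f (phi r) = psi r
      & {in S, forall x, f x != 0 -> x^-1 \in S}].

Definition universal_field_of_fractions (U : unitRingType) (phi : R -> U) :
  Prop :=
  [/\ injective phi, epic_field phi &
      forall (D : unitRingType) (psi : {rmorphism R -> D}),
        epic_field psi -> specializes_to phi psi].

End UniversalField.

Definition free_algebra (K : fieldType) (I : choiceType) : lalgType K :=
  {malg K[{fmonom I}]}.

Definition free_generator (K : fieldType) (I : choiceType) (i : I) :
  free_algebra K I := << fmu i >>.

Definition laurent (F : nzRingType) := {malg F[int]}.

Section Laurent.
Variable F : nzRingType.
HB.instance Definition _ := GRing.Zmodule.on (laurent F).
Implicit Types f g h : laurent F.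

Definition laurent_monomial (x : F) (k : int) : laurent F := << x *g k >>.

Definition laurent_mul f g : laurent F :=
  \sum_(k <- msupp f) \sum_(l <- msupp g)
    laurent_monomial (f@_k * g@_l) (k + l).

Lemma laurent_mulw (d1 d2 : {fset int}) f g :
  (msupp f `<=` d1)%fset -> (msupp g `<=` d2)%fset ->
  laurent_mul f g = \sum_(k <- d1) \sum_(l <- d2)
    laurent_monomial (f@_k * g@_l) (k + l).
Proof.
move=> le1 le2; rewrite /laurent_mul (big_fset_incl _ le1) /=.
  apply: eq_bigr => k _; apply: big_fset_incl => // l _ /mcoeff_outdom ->.
  by rewrite mulr0 /laurent_monomial monalgU0.
move=> k _ /mcoeff_outdom fk; rewrite big1 // => l _.
by rewrite fk mul0r /laurent_monomial monalgU0.
Qed.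

Lemma laurent_mulDl : left_distributive laurent_mul +%R.
Proof.
move=> f g h.
rewrite (laurent_mulw (msuppD_le f g) (fsubset_refl _)).
rewrite (laurent_mulw (fsubsetUl _ (msupp g)) (fsubset_refl _)).
rewrite (laurent_mulw (fsubsetUr (msupp f) _) (fsubset_refl _)).
rewrite -big_split; apply: eq_bigr => k _.
rewrite -big_split; apply: eq_bigr => l _.
by rewrite mcoeffD mulrDl /laurent_monomial monalgUD.
Qed.

Lemma laurent_mulDr : right_distributive laurent_mul +%R.
Proof.
move=> h f g.
rewrite (laurent_mulw (fsubset_refl _) (msuppD_le f g)).
rewrite (laurent_mulw (fsubset_refl _) (fsubsetUl _ (msupp g))).
rewrite (laurent_mulw (fsubset_refl _) (fsubsetUr (msupp f) _)).
rewrite -big_split; apply: eq_bigr => k _.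
rewrite -big_split; apply: eq_bigr => l _.
by rewrite mcoeffD mulrDr /laurent_monomial monalgUD.
Qed.

Lemma laurent_mul0l : left_zero 0 laurent_mul.
Proof. by move=> f; rewrite /laurent_mul msupp0 big_seq_fset0. Qed.

Lemma laurent_mul0r : right_zero 0 laurent_mul.
Proof.
by move=> f; rewrite /laurent_mul big1 // => k _; rewrite msupp0 big_seq_fset0.
Qed.

Lemma laurent_mul_monomial x y k l :
  laurent_mul (laurent_monomial x k) (laurent_monomial y l) =
  laurent_monomial (x * y) (k + l).
Proof.
by rewrite (laurent_mulw msuppU_le msuppU_le) !big_seq_fset1 !mcoeffUU.
Qed.

Lemma laurentE f : f = \sum_(k <- msupp f) laurent_monomial f@_k k.
Proof. exact: monalgE. Qed.

Lemma laurent_mul_suml (I : Type) (r : seq I) (E : I -> laurent F) g :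
  laurent_mul (\sum_(i <- r) E i) g = \sum_(i <- r) laurent_mul (E i) g.
Proof.
exact: (big_morph (laurent_mul^~ g) (fun _ _ => laurent_mulDl _ _ _)
          (laurent_mul0l g)).
Qed.

Lemma laurent_mul_sumr (I : Type) (r : seq I) (E : I -> laurent F) g :
  laurent_mul g (\sum_(i <- r) E i) = \sum_(i <- r) laurent_mul g (E i).
Proof.
exact: (big_morph (laurent_mul g) (fun _ _ => laurent_mulDr _ _ _)
          (laurent_mul0r g)).
Qed.

Lemma laurent_mulA : associative laurent_mul.
Proof.
move=> f g h; rewrite (laurentE f) !laurent_mul_suml; apply: eq_bigr => k _.
rewrite (laurentE g) laurent_mul_sumr !laurent_mul_suml laurent_mul_sumr.
apply: eq_bigr => l _; rewrite (laurentE h) !laurent_mul_sumr.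
by apply: eq_bigr => m _; rewrite !laurent_mul_monomial mulrA addrA.
Qed.

Definition laurent_one : laurent F := laurent_monomial 1 0.

Lemma laurent_mul1l : left_id laurent_one laurent_mul.
Proof.
move=> f; rewrite [RHS]laurentE {1}(laurentE f) laurent_mul_sumr.
by apply: eq_bigr => k _; rewrite laurent_mul_monomial mul1r add0r.
Qed.

Lemma laurent_mul1r : right_id laurent_one laurent_mul.
Proof.
move=> f; rewrite [RHS]laurentE {1}(laurentE f) laurent_mul_suml.
by apply: eq_bigr => k _; rewrite laurent_mul_monomial mulr1 addr0.
Qed.

Lemma laurent_one_neq0 : laurent_one != 0.
Proof. by rewrite monalgU_eq0 oner_eq0. Qed.

HB.instance Definition _ := GRing.Zmodule_isNzRing.Build (laurent F)
  laurent_mulA laurent_mul1l laurent_mul1r laurent_mulDl laurent_mulDr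
  laurent_one_neq0.

End Laurent.

(* [Left], [Bottom], [Right], [Top] stand for the letters a, b, c, d. *)
Inductive side := Left | Bottom | Right | Top.

Definition side_code (s : side) : 'I_4 :=
  match s with Left => inord 0 | Bottom => inord 1 | Right => inord 2
             | Top => inord 3 end.
Definition side_decode (i : 'I_4) : side :=
  match val i with 0 => Left | 1 => Bottom | 2 => Right | _ => Top end%N.
Lemma side_codeK : cancel side_code side_decode.
Proof. by case; rewrite /side_decode /= inordK. Qed.
HB.instance Definition _ := Finite.copy side (can_type side_codeK).

(* For n > 1, ['Z_n] is the set of indices 1, ..., n read mod n. *)
Definition generator (n : nat) := (side * 'Z_n)%type.

Section Weights.
Variables (n : nat) (F : unitAlgType rat) (gen : generator n -> F).

(* The half of the table of brackets of generators which is given explicitly;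
   the other half follows by skew-symmetry. *)
Definition edge_bracket (s t : side) (i : 'Z_n) : tensor F F :=
  let a := gen (Left, i) in let b := gen (Bottom, i) in
  let c := gen (Right, i) in let d := gen (Top, i) in
  match s, t with
  | Bottom, Left  => 2^-1 *: (b \ox a)
  | Bottom, Right => 2^-1 *: (c \ox b)
  | Left, Top     => 2^-1 *: (1 \ox (a * d))
  | Right, Top    => 2^-1 *: ((d * c) \ox 1)
  | _, _          => 0
  end.

Definition network_bracket (db : F -> F -> tensor F F) : Prop :=
  double_bracket db /\
  forall (s t : side) (i j : 'Z_n),
    db (gen (s, i)) (gen (t, j)) =
    if i == j then edge_bracket s t i - tensor_flip (edge_bracket t s i)
    else 0.

Let a (i : int) : F := gen (Left, i%:~R).
Let b (i : int) : F := gen (Bottom, i%:~R).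
Let c (i : int) : F := gen (Right, i%:~R).
Let d (i : int) : F := gen (Top, i%:~R).

Definition zprod (k : nat) : F :=
  (\prod_(1 <= i < k) (d i%:Z * c i%:Z)) * d k%:Z.

Definition Zweight : F := zprod n * c n%:Z.

Definition zpath (k : int) : F :=
  match k with
  | Posz k'.+1 => zprod k'.+1
  | Posz 0     => Zweight^-1 * zprod n
  | Negz _     => Zweight^-1 * zprod n.-1  (* only used for k = -1 *)
  end.

Definition Xweight (i : int) : F :=
  zpath (i - 2) * a i / c (i - 1) / d (i - 1) / c (i - 2)
  / zpath (i - 2).

Definition Yweight (i : int) : F :=
  zpath (i - 2) * b i / c i / d i / c (i - 1) / d (i - 1) / c (i - 2)
  / zpath (i - 2).

Definition Lbullet : {pred F} :=
  generated_subalgebra (fun x : F =>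
    x = Zweight \/ x = Zweight^-1 \/
    exists2 i : nat, (1 <= i <= n)%N &
      [\/ x = Xweight i, x = (Xweight i)^-1, x = Yweight i
        | x = (Yweight i)^-1]).

End Weights.

Inductive corner := TL | TR | BL | BR.

Definition corner_code (s : corner) : 'I_4 :=
  match s with TL => inord 0 | TR => inord 1 | BL => inord 2
             | BR => inord 3 end.
Definition corner_decode (i : 'I_4) : corner :=
  match val i with 0 => TL | 1 => TR | 2 => BL | _ => BR end%N.
Lemma corner_codeK : cancel corner_code corner_decode.
Proof. by case; rewrite /corner_decode /= inordK. Qed.
HB.instance Definition _ := Finite.copy corner (can_type corner_codeK).

(* The ordinals [s : 'I_3] and [i : 'I_n] stand for the source or sink s + 1
   and the face i + 1. *)
Inductive vertex (n : nat) :=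
  Source of 'I_3 | Sink of 'I_3 | Corner of corner & 'I_n.
Arguments Source {n}.
Arguments Sink {n}.
Arguments Corner {n}.

Definition vertex_code n (v : vertex n) : 'I_3 + 'I_3 + corner * 'I_n :=
  match v with
  | Source s => inl (inl s) | Sink s => inl (inr s) | Corner x i => inr (x, i)
  end.
Definition vertex_decode n (v : 'I_3 + 'I_3 + corner * 'I_n) : vertex n :=
  match v with
  | inl (inl s) => Source s | inl (inr s) => Sink s | inr (x, i) => Corner x i
  end.
Lemma vertex_codeK n : cancel (@vertex_code n) (@vertex_decode n).
Proof. by case. Qed.
HB.instance Definition _ n := Finite.copy (vertex n) (can_type (@vertex_codeK n)).

Definition num (m : nat) (i : 'I_m) : nat := i.+1.

Section Network.
Variables (n : nat) (F : nzRingType) (X Y : nat -> F) (Z : F).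
Local Open Scope nat_scope.

Definition arrow (u v : vertex n) : bool :=
  match u, v with
  | Corner BL i, Corner TL j
  | Corner BL i, Corner BR j
  | Corner TL i, Corner TR j
  | Corner TR i, Corner BR j => i == j
  | Corner BR i, Corner TL j => num j == num i + 1
  | Corner TR i, Corner BL j => num j == num i + 2
  | Source s, Corner TL i => (num s == 1) && (num i == 1)
  | Source s, Corner BL i =>
      ((num s == 2) && (num i == 1)) || ((num s == 3) && (num i == 2))
  | Corner BR i, Sink t => (num t == 1) && (num i == n)
  | Corner TR i, Sink t =>
      ((num t == 2) && (num i == n.-1)) || ((num t == 3) && (num i == n))
  | _, _ => false
  end.

(* The weight of the arrow from [u] to [v], meaningful when [arrow u v]. *)
Definition weight (u v : vertex n) : F :=
  match u, v with
  | Corner BL i, Corner TL _ => X (num i)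
  | Corner BL i, Corner BR _ => Y (num i)
  | Corner _ _, Sink _ => Z
  | _, _ => 1%R
  end.

(* In the planar drawing br_n, tr_(n-1), tr_n lie on strands n+1, n-1, n mod 3,
   while sinks 1, 2, 3 are glued to sources 1, 2, 3, which lie on strands
   1, 2, 3. When 3 does not divide n, the right end of the cylinder has to be
   turned by one strand, upward for n = 1 mod 3 and downward for n = 2 mod 3,
   for the cut to close up on the torus. This takes the last arrow of one strand
   across the cut; without it the involutivity of the coefficients of
   tr(B^i) fails (for instance for n = 4). *)
Definition rim_turn (t : 'I_3) : int :=
  match (n %% 3)%N, num t with
  | 1, 3 => (-1)%R
  | 2, 1 => 1%R
  | _, _ => 0%R
  end.

(* The signed number of downward crossings of the cut by the arrow from [u] to
   [v], meaningful when [arrow u v]. *)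
Definition crossing (u v : vertex n) : int :=
  match u, v with
  | Corner BR _, Corner TL j => if (3 %| num j)%N then 1%R else 0%R
  | Corner TR i, Corner BL _ => if (3 %| num i)%N then (-1)%R else 0%R
  | Corner TR i, Sink t =>
      ((if (3 %| num i)%N then -1 else 0) + rim_turn t)%R
  | Corner BR _, Sink t => rim_turn t
  | _, _ => 0%R
  end.

Definition modified_weight (u v : vertex n) : laurent F :=
  laurent_monomial (weight u v) (crossing u v).

Fixpoint path_weight (u : vertex n) (p : seq (vertex n)) : laurent F :=
  if p is v :: q then (modified_weight u v * path_weight v q)%R else 1%R.

(* The network is acyclic, so that every directed path is counted below: see
   [directed_path_size]. *)
Definition boundary_measurement : 'M[laurent F]_3 :=
  (\matrix_(s, t) \sum_(m < #|{: vertex n}|)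
     \sum_(p : m.-tuple (vertex n) |
             path arrow (Source s) p && (last (Source s) p == Sink t))
       path_weight (Source s) p)%R.

Definition t_coef (i : nat) (k : int) : F :=
  ((\tr (boundary_measurement ^+ i) : {malg F[int]})@_k)%R.

Definition height (v : vertex n) : nat :=
  match v with
  | Source _ => 0
  | Corner BL i => 4 * i + 1
  | Corner TL i => 4 * i + 2
  | Corner TR i => 4 * i + 3
  | Corner BR i => 4 * i + 4
  | Sink _ => 4 * n + 1
  end.

Lemma arrow_height u v : arrow u v -> height u < height v.
Proof.
case: u => [s|s|[] i]; case: v => [t|t|[] j] //=; rewrite /num /=;
  by [lia | move=> /eqP ->; lia].
Qed.

Lemma directed_path_size u p : path arrow u p -> size p < #|{: vertex n}|.
Proof.
move=> up; have : uniq (u :: p).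
  apply: (@map_uniq _ _ height); apply: (sorted_uniq ltn_trans ltnn).
  by rewrite sorted_map /=; apply: sub_path up => x y; apply: arrow_height.
by move=> /card_uniqP /= <-; apply: max_card.
Qed.

End Network.

Definition t_ (n : nat) (F : unitAlgType rat) (gen : generator n -> F) :
    nat -> int -> F :=
  t_coef n (fun i : nat => Xweight gen i) (fun i : nat => Yweight gen i)
    (Zweight gen).

(* Main.v *)
(* Up to conjugation by the gauge factors, B is a power of lambda times the
   monodromy T_1 ... T_n of transfer matrices, where T_m only involves the
   weights of the face m and brackets of weights of distinct faces vanish. The
   map H = {t_ik, -} is a derivation, which does not change when t_ik is replaced
   by a conjugate, and on the weights of a face it inserts the closed paths which
   take the other branch at a vertex. Let P_m be lambda^-k times the i-th power
   of the monodromy starting behind the face m, and R(P) the difference of the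
   parts of positive and negative degree of P for the principal grading. Then
   2 H(T_m) = i (R(P_(m-1)) T_m - T_m R(P_m)): as P_(m-1) T_m = T_m P_m, only
   nine coefficients of this equation are not trivial. Multiplying up and
   conjugating, H(B) = [M, B], and the gauge factors contribute to M only
   elements of L. Hence H(tr B^j) = tr [M, B^j] is a sum of commutators in L. *)

Require Import Defs.
From HB Require Import structures.
From mathcomp Require Import all_boot all_order all_algebra.
From mathcomp Require Import finmap monalg.
From mathcomp Require Import generic_quotient ring_quotient boolp zify.
From Stdlib Require Ncring Ncring_tac.

Set Implicit Arguments.
Unset Strict Implicit.
Unset Printing Implicit Defensive.

Import GRing.Theory.
Local Open Scope ring_scope.

(** * Double brackets *)

(** The double bracket enters only through [psi x r = \sum x' r x''], where
    [db x y = \sum x' \ox x'']. As a function of [x] this is a derivation for the inner bimodule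
    structure, hence [psi] is cyclic: that is why H ignores conjugations, and why a power, and then
    a product over the faces, can be taken apart, the rest of the closed path being inserted as [r].
    The coefficient of lambda^k is reached by pairing with the central element lambda^-k. Equations
    are doubled to clear the factors 1/2 of the bracket.

    The obstacle is that the class has to vanish modulo commutators of L, while the Lax equation is
    found in the weights of the faces, where it only gives commutators in F. Returning to B
    conjugates by the diagonal matrix of the gauge factors 1, z_(-1), z_0 of the vertices next to
    the sources. H moves these too, so M acquires the logarithmic derivative of this matrix. It is
    computed from the flow of the partial products z_k, and each of its terms turns out to be a
    coefficient of a conjugate of P_n which is a power of B times a power of lambda, up to an
    integer factor. *)

Section TensorTheory.
Variables (K : fieldType) (U V : lmodType K).

Lemma tensor_lift0 (W : lmodType K) (f : U -> V -> W) :
  bilinear_map f -> tensor_lift f 0 = 0.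
Proof. exact: tensor_lift_zero. Qed.

Lemma tensor_liftD (W : lmodType K) (f : U -> V -> W) :
  bilinear_map f -> {morph tensor_lift f : s t / s + t}.
Proof. move=> fb s t; exact: tensor_lift_add. Qed.

Lemma tensor_liftN (W : lmodType K) (f : U -> V -> W) :
  bilinear_map f -> {morph tensor_lift f : t / - t}.
Proof. move=> fb t; exact: tensor_lift_opp. Qed.

Lemma tensor_liftZ (W : lmodType K) (f : U -> V -> W) k :
  bilinear_map f -> {morph tensor_lift f : t / k *: t}.
Proof. move=> fb t; exact: tensor_lift_scale. Qed.

Lemma tensor_sum_tens (t : tensor U V) :
  t = \sum_(p <- repr t) p.1 \ox p.2.
Proof.
apply: tensorP => W f fb.
rewrite (big_morph _ (tensor_liftD fb) (tensor_lift0 fb)).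
by apply: eq_bigr => p _; rewrite tensor_lift_tens.
Qed.

Lemma tensor_ind (P : tensor U V -> Prop) :
  P 0 -> (forall s t, P s -> P t -> P (s + t)) ->
  (forall x y, P (x \ox y)) -> forall t, P t.
Proof.
move=> P0 PD Pt t; rewrite (tensor_sum_tens t).
by elim/big_ind: _ => // p _; apply: Pt.
Qed.

Lemma tensDl (y : V) : {morph (fun x : U => x \ox y) : x x' / x + x'}.
Proof.
by move=> x x'; have /= := (tens_bilinear U V).1 y 1 x x'; rewrite !scale1r.
Qed.

Lemma tensZl (k : K) (x : U) (y : V) : (k *: x) \ox y = k *: (x \ox y).
Proof. exact: (scalable_linear ((tens_bilinear U V).1 y) k x). Qed.

Lemma flip_bilinear : bilinear_map (fun (x : U) (y : V) => y \ox x).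
Proof.
by have [Hl Hr] := tens_bilinear V U; split=> ?; [apply: Hr | apply: Hl].
Qed.

Lemma tensor_flip_tens (x : U) (y : V) : tensor_flip (x \ox y) = y \ox x.
Proof. exact: (tensor_lift_tens flip_bilinear). Qed.

Lemma tensor_flipD : {morph @tensor_flip K U V : s t / s + t}.
Proof. exact: (tensor_liftD flip_bilinear). Qed.

Lemma tensor_flip0 : @tensor_flip K U V 0 = 0.
Proof. exact: (tensor_lift0 flip_bilinear). Qed.

Lemma tensor_flipZ k : {morph @tensor_flip K U V : t / k *: t}.
Proof. exact: (tensor_liftZ k flip_bilinear). Qed.

End TensorTheory.

Section TensorMult.
Variables (K : fieldType) (A : algType K).

Lemma tensor_flipM : {morph @tensor_flip K A A : s t / s * t}.
Proof.
move=> s t; elim/tensor_ind: s => [|s s' IH IH'|x y].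
- by rewrite tensor_flip0 !mul0r tensor_flip0.
- by rewrite mulrDl !tensor_flipD mulrDl IH IH'.
elim/tensor_ind: t => [|t t' IH IH'|u v].
- by rewrite tensor_flip0 !mulr0 tensor_flip0.
- by rewrite mulrDr !tensor_flipD mulrDr IH IH'.
by rewrite tens_mul !tensor_flip_tens tens_mul.
Qed.

Lemma mult_bilinear : bilinear_map (@GRing.mul A).
Proof.
by split=> [y k x x'|x k y y']; rewrite ?mulrDl ?mulrDr -?scalerAl -?scalerAr.
Qed.

Lemma tensor_mult_tens (x y : A) : tensor_mult (x \ox y) = x * y.
Proof. exact: (tensor_lift_tens mult_bilinear). Qed.

Lemma tensor_mult0 : @tensor_mult K A 0 = 0.
Proof. exact: (tensor_lift0 mult_bilinear). Qed.

Lemma tensor_multD : {morph @tensor_mult K A : s t / s + t}.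
Proof. exact: (tensor_liftD mult_bilinear). Qed.

Lemma tensor_multN : {morph @tensor_mult K A : t / - t}.
Proof. exact: (tensor_liftN mult_bilinear). Qed.

Lemma tensor_mult_outer_l (t : tensor A A) x :
  tensor_mult ((x \ox 1) * t) = x * tensor_mult t.
Proof.
elim/tensor_ind: t => [|s t IHs IHt|u v].
- by rewrite mulr0 tensor_mult0 mulr0.
- by rewrite mulrDr !tensor_multD IHs IHt mulrDr.
by rewrite tens_mul !tensor_mult_tens mul1r mulrA.
Qed.

Lemma tensor_mult_outer_r (t : tensor A A) x :
  tensor_mult (t * (1 \ox x)) = tensor_mult t * x.
Proof.
elim/tensor_ind: t => [|s t IHs IHt|u v].
- by rewrite mul0r tensor_mult0 mul0r.
- by rewrite mulrDl !tensor_multD IHs IHt mulrDl.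
by rewrite tens_mul !tensor_mult_tens mulr1 mulrA.
Qed.

(** Left multiplication by [1 \ox x] and right multiplication by [r \ox 1] both act between the two
    tensor factors, so [x] lands behind [r] once the factors are multiplied. *)
Lemma tensor_mult_inner (t : tensor A A) x r :
  tensor_mult ((1 \ox x) * t * (r \ox 1)) = tensor_mult (t * ((r * x) \ox 1)).
Proof.
elim/tensor_ind: t => [|s t IHs IHt|u v].
- by rewrite mulr0 !mul0r.
- by rewrite mulrDr !mulrDl !tensor_multD IHs IHt.
by rewrite !tens_mul !tensor_mult_tens mul1r !mulr1 !mulrA.
Qed.

End TensorMult.

(* Abstracts [fun x r => \sum x' r x''] for a linear map x |-> \sum x' (x) x''
   which is a derivation for the inner bimodule structure. *)
Record cyclic_form (A : pzRingType) (V : zmodType) (psi : A -> A -> V) : Prop :=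
  CyclicForm {
    cyclicDl : forall r, {morph psi^~ r : x y / x + y};
    cyclicDr : forall x, {morph psi x : r s / r + s};
    cyclicM : forall x y r, psi (x * y) r = psi x (y * r) + psi y (r * x)
  }.

Section CyclicForm.
Variables (A : pzRingType) (V : zmodType) (psi : A -> A -> V).
Hypothesis psi_cyc : cyclic_form psi.

Lemma cyclic0l r : psi 0 r = 0.
Proof.
by apply: (@addrI _ (psi 0 r)); rewrite -(cyclicDl psi_cyc) !addr0.
Qed.

Lemma cyclic0r x : psi x 0 = 0.
Proof.
by apply: (@addrI _ (psi x 0)); rewrite -(cyclicDr psi_cyc) !addr0.
Qed.

Lemma cyclic1l r : psi 1 r = 0.
Proof.
apply: (@addrI _ (psi 1 r)); rewrite addr0.
by have := cyclicM psi_cyc 1 1 r; rewrite !mul1r mulr1.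
Qed.

Lemma cyclic_suml (I : Type) (s : seq I) (P : pred I) (E : I -> A) r :
  psi (\sum_(i <- s | P i) E i) r = \sum_(i <- s | P i) psi (E i) r.
Proof.
exact: (big_morph (psi^~ r) (fun _ _ => cyclicDl psi_cyc r _ _) (cyclic0l r)).
Qed.

Lemma cyclic_sumr (I : Type) (s : seq I) (P : pred I) (E : I -> A) x :
  psi x (\sum_(i <- s | P i) E i) = \sum_(i <- s | P i) psi x (E i).
Proof.
exact: (big_morph (psi x) (fun _ _ => cyclicDr psi_cyc x _ _) (cyclic0r x)).
Qed.

(** Trace property: for [r = 1], or [r] a power of lambda, [psi] does not see conjugation of its
    first argument. *)
Lemma cyclic_comm x y r : GRing.comm x r -> GRing.comm y r ->
  psi (x * y) r = psi (y * x) r.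
Proof.
by move=> cx cy; rewrite !(cyclicM psi_cyc) addrC -cx -cy.
Qed.

Lemma cyclic_conj g g' x r : g' * g = 1 -> GRing.comm g r -> GRing.comm g' r ->
  GRing.comm x r -> psi (g * x * g') r = psi x r.
Proof.
move=> gg' cg cg' cx; rewrite -mulrA cyclic_comm -?mulrA ?gg' ?mulr1 //.
by apply: commr_sym; apply: commrM; apply: commr_sym.
Qed.

(** As [x] commutes with [r], all terms of the Leibniz rule agree after rotation. This is the origin
    of the factor i in the Lax equation. *)
Lemma cyclicX x r n : GRing.comm x r ->
  psi (x ^+ n.+1) r = psi x (x ^+ n * r) *+ n.+1.
Proof.
move=> cx; elim: n r cx => [|n IH] r cx; first by rewrite mul1r.
rewrite exprS (cyclicM psi_cyc) -cx IH; last first.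
  by rewrite /GRing.comm -!mulrA cx.
by rewrite mulrA -exprSr [RHS]mulrS.
Qed.

(** The second argument is what remains of the closed path when the factor [T m] is cut out, read
    from its right to its left side. *)
Lemma cyclic_prod n (T : nat -> A) r :
  psi (\prod_(0 <= m < n) T m) r =
  \sum_(0 <= m < n)
    psi (T m) ((\prod_(m.+1 <= j < n) T j) * r * \prod_(0 <= j < m) T j).
Proof.
elim: n r => [|n IH] r; first by rewrite !big_geq // cyclic1l.
rewrite [in LHS]big_nat_recr //= [in RHS]big_nat_recr //= (cyclicM psi_cyc) IH.
rewrite (@big_geq _ _ _ n.+1) // mul1r.
congr (_ + _); apply: eq_big_nat => m /andP[_ ltmn].
by rewrite big_nat_recr //= !mulrA.
Qed.

End CyclicForm.

Section DoubleBracket.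
Variables (K : fieldType) (A : algType K) (db : A -> A -> tensor A A).
Hypothesis dbP : double_bracket db.

Lemma db_addl y : {morph db^~ y : x x' / x + x'}.
Proof.
by move=> x x'; have /= := (db_bilinear dbP).1 y 1 x x'; rewrite !scale1r.
Qed.

Lemma db_addr x : {morph db x : y y' / y + y'}.
Proof.
by move=> y y'; have /= := (db_bilinear dbP).2 x 1 y y'; rewrite !scale1r.
Qed.

(** Skew-symmetry turns the outer Leibniz rule in the second argument into an inner one in the
    first. *)
Lemma db_leibniz_l x x' y :
  db (x * x') y = db x y * (x' \ox 1) + (1 \ox x) * db x' y.
Proof.
rewrite (db_skew dbP y) (db_leibniz dbP) tensor_flipD !tensor_flipM.
rewrite !tensor_flip_tens opprD (db_skew dbP y x) (db_skew dbP y x').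
by rewrite mulNr mulrN.
Qed.

(** This is [\sum x' r x''] for [db x y = \sum x' \ox x'']. In a closed path made up of [x] and [r],
    it is the contribution of [x] to the bracket with [y]. *)
Definition loop_insertion (y x r : A) : A := tensor_mult (db x y * (r \ox 1)).

Lemma loop_insertion_cyclic y : cyclic_form (loop_insertion y).
Proof.
split=> [r x x'|x r s|x x' r]; rewrite /loop_insertion.
- by rewrite db_addl mulrDl tensor_multD.
- by rewrite -tensor_multD -mulrDr tensDl.
rewrite db_leibniz_l mulrDl tensor_multD tensor_mult_inner -mulrA tens_mul.
by rewrite mulr1.
Qed.

Lemma tensor_mult_db y x : tensor_mult (db x y) = loop_insertion y x 1.
Proof. by rewrite /loop_insertion (mulr1 (db x y)). Qed.

Lemma bracket_derivation x y z :
  tensor_mult (db x (y * z)) =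
  tensor_mult (db x y) * z + y * tensor_mult (db x z).
Proof.
by rewrite (db_leibniz dbP) tensor_multD tensor_mult_outer_l tensor_mult_outer_r.
Qed.

End DoubleBracket.

(** * Laurent polynomials *)

Section LaurentTheory.
Variable F : nzRingType.
Implicit Types f g : laurent F.

Lemma laurent_coef0 k : (0 : laurent F)@_k = 0.
Proof. exact: mcoeff0. Qed.

Lemma laurent_coefD f g k : (f + g)@_k = f@_k + g@_k.
Proof. exact: mcoeffD. Qed.

Lemma laurent_coefB f g k : (f - g)@_k = f@_k - g@_k.
Proof. exact: mcoeffB. Qed.

Lemma laurent_coef_sum (I : Type) (r : seq I) (P : pred I)
    (E : I -> laurent F) k :
  (\sum_(i <- r | P i) E i)@_k = \sum_(i <- r | P i) (E i)@_k.
Proof. exact: (raddf_sum (mcoeff k)). Qed.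

Lemma laurent_monomialD k : {morph @laurent_monomial F ^~ k : x y / x + y}.
Proof. exact: monalgUD. Qed.

Lemma laurent_monomialM (x y : F) k l :
  laurent_monomial x k * laurent_monomial y l = laurent_monomial (x * y) (k + l).
Proof. exact: laurent_mul_monomial. Qed.

Lemma laurent_coefMw (d : {fset int}) f g k : (msupp f `<=` d)%fset ->
  (f * g)@_k = \sum_(p <- d) f@_p * g@_(k - p).
Proof.
move=> le_d; rewrite -[f * g]/(laurent_mul f g).
rewrite (laurent_mulw le_d (fsubset_refl _)) raddf_sum; apply: eq_bigr => p _.
rewrite raddf_sum /= [in RHS](monalgE g) raddf_sum mulr_sumr.
apply: eq_bigr => l _ /=; rewrite !mcoeffU -mulrnAr.
by congr (_ * (_ *+ nat_of_bool _)); lia.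
Qed.

Lemma laurent_coefM f g k :
  (f * g)@_k = \sum_(p <- msupp f) f@_p * g@_(k - p).
Proof. exact: laurent_coefMw (fsubset_refl _). Qed.

Lemma laurent_coefUM (x : F) p g k :
  (laurent_monomial x p * g)@_k = x * g@_(k - p).
Proof.
by rewrite (laurent_coefMw _ _ msuppU_le) big_seq_fset1 mcoeffUU.
Qed.

Lemma laurent_coefMU f (y : F) q k :
  (f * laurent_monomial y q)@_k = f@_(k - q) * y.
Proof.
rewrite laurent_coefM [in RHS](monalgE f) raddf_sum mulr_suml.
apply: eq_bigr => p _; rewrite /= !mcoeffU mulrnAr mulrnAl.
by congr (_ *+ nat_of_bool _); lia.
Qed.

Lemma laurent_ind (P : laurent F -> Prop) :
  P 0 -> (forall f g, P f -> P g -> P (f + g)) ->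
  (forall x k, P (laurent_monomial x k)) -> forall f, P f.
Proof.
move=> P0 PD PU f; rewrite (laurentE f).
by elim/big_ind: _ => // k _; apply: PU.
Qed.

Lemma laurentP f g : (forall k, f@_k = g@_k) -> f = g.
Proof. by move=> fg; apply/malgP. Qed.

(** The map may depend on the exponent because the sign in [rmatrix] does. *)
Definition laurent_map (phi : int -> F -> F) f : laurent F :=
  \sum_(k <- msupp f) laurent_monomial (phi k f@_k) k.

Lemma laurent_coef_map phi f k : phi k 0 = 0 ->
  (laurent_map phi f)@_k = phi k f@_k.
Proof.
move=> phi0; rewrite raddf_sum.
have [fk|/mcoeff_outdom fk] := boolP (k \in msupp f); last first.
  rewrite fk phi0 big_seq big1 // => l lf; rewrite /= mcoeffU.
  by case: eqP lf => // -> ; rewrite -mcoeff_neq0 fk eqxx.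
rewrite (bigD1_seq k) //= mcoeffUU big1 ?addr0 // => l /negPf lk.
by rewrite /= mcoeffU lk.
Qed.

Lemma laurent_monomial_central f k : GRing.comm (laurent_monomial 1 k) f.
Proof.
by apply: laurentP => l; rewrite laurent_coefUM laurent_coefMU mul1r mulr1.
Qed.

End LaurentTheory.

(* A pairing [psi] on F induces the constant term of the pairing on
   F[lambda^+-1], and then the trace of the pairing on 3 x 3 matrices. *)
Section CyclicExtensions.
Variables (F : nzRingType) (V : zmodType) (psi : F -> F -> V).
Hypothesis psi_cyc : cyclic_form psi.

Definition laurent_form (f g : laurent F) : V :=
  \sum_(k <- msupp f) psi f@_k g@_(- k).

Lemma laurent_formw (d : {fset int}) f g : (msupp f `<=` d)%fset ->
  laurent_form f g = \sum_(k <- d) psi f@_k g@_(- k).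
Proof.
move=> le_d; apply: big_fset_incl => // k _ /mcoeff_outdom ->.
exact: cyclic0l.
Qed.

Lemma laurent_formU x k g : laurent_form (laurent_monomial x k) g = psi x g@_(- k).
Proof. by rewrite (laurent_formw _ msuppU_le) big_seq_fset1 mcoeffUU. Qed.

Lemma laurent_formDl g : {morph laurent_form^~ g : f f' / f + f'}.
Proof.
move=> f f'; rewrite (laurent_formw _ (msuppD_le f f')).
rewrite (laurent_formw _ (fsubsetUl _ (msupp f'))).
rewrite (laurent_formw _ (fsubsetUr (msupp f) _)) -big_split.
by apply: eq_bigr => k _; rewrite mcoeffD (cyclicDl psi_cyc).
Qed.

Lemma laurent_formDr f : {morph laurent_form f : g g' / g + g'}.
Proof.
move=> g g'; rewrite -big_split.
by apply: eq_bigr => k _; rewrite mcoeffD (cyclicDr psi_cyc).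
Qed.

Lemma laurent_form_cyclic : cyclic_form laurent_form.
Proof.
have form0 g : laurent_form 0 g = 0 by rewrite /laurent_form msupp0 big_seq_fset0.
have form0r g : laurent_form g 0 = 0.
  by rewrite /laurent_form big1 // => k _; rewrite mcoeff0 cyclic0r.
split; [exact: laurent_formDl | exact: laurent_formDr |].
move=> f g h; elim/laurent_ind: f => [|f f' IH IH'|x k].
- by rewrite mul0r mulr0 !form0 form0r addr0.
- by rewrite mulrDl mulrDr !laurent_formDl laurent_formDr IH IH' addrACA.
elim/laurent_ind: g => [|g g' IH IH'|y l].
- by rewrite mul0r mulr0 !form0 form0r addr0.
- by rewrite mulrDl mulrDr !laurent_formDl laurent_formDr IH IH' addrACA.
rewrite laurent_monomialM !laurent_formU (cyclicM psi_cyc) laurent_coefUM.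
by rewrite laurent_coefMU opprD [- l - k]addrC.
Qed.

End CyclicExtensions.

Section MatrixForm.
Variables (R : nzRingType) (V : zmodType) (psi : R -> R -> V) (m : nat).
Hypothesis psi_cyc : cyclic_form psi.

Definition matrix_form (A B : 'M[R]_m.+1) : V :=
  \sum_s \sum_t psi (A s t) (B t s).

Lemma matrix_form_cyclic : cyclic_form matrix_form.
Proof.
split=> [C A B|A B C|A B C].
- rewrite -big_split; apply: eq_bigr => s _; rewrite -big_split.
  by apply: eq_bigr => t _; rewrite mxE (cyclicDl psi_cyc).
- rewrite -big_split; apply: eq_bigr => s _; rewrite -big_split.
  by apply: eq_bigr => t _; rewrite mxE (cyclicDr psi_cyc).
have -> : matrix_form (A * B) C =
    \sum_s \sum_t \sum_u (psi (A s u) (B u t * C t s) +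
                          psi (B u t) (C t s * A s u)).
  apply: eq_bigr => s _; apply: eq_bigr => t _; rewrite mxE.
  rewrite (cyclic_suml psi_cyc); apply: eq_bigr => u _.
  exact: cyclicM.
have -> : matrix_form A (B * C) =
    \sum_s \sum_t \sum_u psi (A s u) (B u t * C t s).
  apply: eq_bigr => s _; rewrite exchange_big; apply: eq_bigr => u _ /=.
  by rewrite mxE (cyclic_sumr psi_cyc).
have -> : matrix_form B (C * A) =
    \sum_s \sum_t \sum_u psi (B u t) (C t s * A s u).
  rewrite exchange_big /= /matrix_form exchange_big; apply: eq_bigr => t _ /=.
  rewrite exchange_big; apply: eq_bigr => u _ /=.
  by rewrite mxE (cyclic_sumr psi_cyc).
rewrite -big_split; apply: eq_bigr => s _ /=; rewrite -big_split.
by apply: eq_bigr => t _ /=; rewrite -big_split.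
Qed.

(** Together with [laurent_form_coef] this writes [psi] of a coefficient of a trace as a pairing of
    the matrix itself with a scalar power of lambda. *)
Lemma matrix_form_scalar A x : matrix_form A x%:M = psi (\tr A) x.
Proof.
rewrite (cyclic_suml psi_cyc); apply: eq_bigr => s _.
rewrite (bigD1 s) //= mxE eqxx mulr1n big1 ?addr0 // => t /negPf ts.
by rewrite mxE ts mulr0n (cyclic0r psi_cyc).
Qed.

End MatrixForm.

(** * Transfer matrices *)

(** With these instances [non_commutative_ring] decides the polynomial identities to which the
    equations of a single face reduce. *)
#[local] Instance ring_ops (R : nzRingType) :
  @Ncring.Ring_ops R 0 1 +%R *%R (fun x y => x - y) -%R eq := {}.

#[local] Instance noncommutative_ring (R : nzRingType) :
  Ncring.Ring (Ro := ring_ops R).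
Proof.
split; try exact: _; try by move=> *;
  first [exact: add0r | exact: addrC | exact: addrA | exact: mul1r
       | exact: mulr1 | exact: mulrA | exact: mulrDl | exact: mulrDr
       | exact: addrN | reflexivity].
all: by move=> ? ? -> ? ? ->.
Qed.

Definition strand1 : 'I_3 := ord0.
Definition strand2 : 'I_3 := @Ordinal 3 1 isT.
Definition strand3 : 'I_3 := @Ordinal 3 2 isT.

Variant strand_spec (s : 'I_3) : Type :=
  | Strand1 of s = strand1 | Strand2 of s = strand2 | Strand3 of s = strand3.

Lemma strandP s : strand_spec s.
Proof.
by case: s => [[|[|[|s]]] lts] //;
  [apply: Strand1 | apply: Strand2 | apply: Strand3]; apply: val_inj.
Qed.

Lemma sum_strand (V : nmodType) (E : 'I_3 -> V) :
  \sum_s E s = E strand1 + E strand2 + E strand3.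
Proof.
rewrite !big_ord_recl big_ord0 addr0 addrA.
by congr (E _ + E _ + E _); apply: val_inj.
Qed.

Section TransferMatrix.
Variable F : nzRingType.

(* Rows and columns are the strands entering tl_m, bl_m, bl_(m+1) before the
   face m and tl_(m+1), bl_(m+1), bl_(m+2) behind it. Each arrow
   tr_m -> bl_(m+2) is made to carry the exponent -1 of lambda, and no other
   arrow carries any; see [crossing_TR]. *)
Definition transfer (a b c d : F) : 'M[laurent F]_3 :=
  \matrix_(s, t)
    match val s, val t with
    | 0%N, 0%N => laurent_monomial (d * c) 0
    | 0%N, 2%N => laurent_monomial d (-1)
    | 1%N, 0%N => laurent_monomial (b + a * d * c) 0
    | 1%N, 2%N => laurent_monomial (a * d) (-1)
    | 2%N, 1%N => laurent_monomial 1 0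
    | _, _ => 0
    end.

(* The difference of the projections to positive and negative degrees, for the
   principal grading, in which [lambda] has degree 3. *)
Definition rmatrix (P : 'M[laurent F]_3) : 'M[laurent F]_3 :=
  \matrix_(s, t)
    laurent_map (fun k x => x *~ sgz (t%:Z - s%:Z + 3 * k)) (P s t).

Lemma rmatrix_coef P s t k :
  (rmatrix P s t)@_k = (P s t)@_k *~ sgz (t%:Z - s%:Z + 3 * k).
Proof. by rewrite mxE laurent_coef_map // mul0rz. Qed.

Definition map_derivation (h : F -> F) (A : 'M[laurent F]_3) : 'M[laurent F]_3 :=
  map_mx (laurent_map (fun=> h)) A.

Lemma map_derivation_coef h A s t k : h 0 = 0 ->
  (map_derivation h A s t)@_k = h (A s t)@_k.
Proof. by move=> h0; rewrite mxE laurent_coef_map. Qed.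

End TransferMatrix.

Ltac eval_sgz := repeat match goal with |- context [sgz ?e] =>
  first [ rewrite (_ : sgz e = 1); last by vm_compute
        | rewrite (_ : sgz e = -1); last by vm_compute
        | rewrite (_ : sgz e = 0); last by vm_compute ] end.

(* The images of the weights of a face under the bracket with a sum of closed
   paths: [p], [q], [p'], [q'] sum up the remainders of these paths outside the
   face, from its right to its left side. *)
Definition edge_flow (F : nzRingType) (h : F -> F) (a b c d p q p' q' : F) :=
  [/\ h a *+ 2 = b * q * a - a * d * (c * p + p' + c * q * a + q' * a),
      h b *+ 2 =
        - (a * (d * c * q + d * q') * b) - b * (p * d + q * a * d) * c,
      h c *+ 2 = c * q * b - (c * p + p' + c * q * a + q' * a) * d * c
    & h d *+ 2 =
        (d * c * q + d * q') * a * d + d * c * (p * d + q * a * d)].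

Section Derivation.
Variables (R : pzRingType) (h : R -> R).

Lemma derivation0 : {morph h : x y / x + y} -> h 0 = 0.
Proof. by move=> hD; apply: (@addrI _ (h 0)); rewrite -hD !addr0. Qed.

Lemma derivation1 : (forall x y, h (x * y) = h x * y + x * h y) -> h 1 = 0.
Proof.
move=> hM; apply: (@addrI _ (h 1)).
by have := hM 1 1; rewrite !mulr1 mul1r addr0.
Qed.

End Derivation.

(** * The Lax equation of a single face *)

Section LocalLax.
Variables (F : nzRingType) (a b c d : F).
Let T := transfer a b c d.


Lemma transfer_mull_coef (P : 'M[laurent F]_3) t k :
  [/\ ((T * P) strand1 t)@_k = d * c * (P strand1 t)@_k + d * (P strand3 t)@_(k + 1),
      ((T * P) strand2 t)@_k =
        (b + a * d * c) * (P strand1 t)@_k + a * d * (P strand3 t)@_(k + 1)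
    & ((T * P) strand3 t)@_k = (P strand2 t)@_k].
Proof.
split; rewrite mxE sum_strand /T [transfer _ _ _ _ _ strand1]mxE
  [transfer _ _ _ _ _ strand2]mxE [transfer _ _ _ _ _ strand3]mxE /=.
- by rewrite mul0r addr0 laurent_coefD !laurent_coefUM subr0 opprK.
- by rewrite mul0r addr0 laurent_coefD !laurent_coefUM subr0 opprK.
by rewrite !mul0r add0r addr0 laurent_coefUM subr0 mul1r.
Qed.

Lemma transfer_mulr_coef (P : 'M[laurent F]_3) s k :
  [/\ ((P * T) s strand1)@_k =
        (P s strand1)@_k * (d * c) + (P s strand2)@_k * (b + a * d * c),
      ((P * T) s strand2)@_k = (P s strand3)@_k
    & ((P * T) s strand3)@_k =
        (P s strand1)@_(k + 1) * d + (P s strand2)@_(k + 1) * (a * d)].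
Proof.
split; rewrite mxE sum_strand /T [transfer _ _ _ _ strand1 _]mxE
  [transfer _ _ _ _ strand2 _]mxE [transfer _ _ _ _ strand3 _]mxE /=.
- by rewrite mulr0 addr0 laurent_coefD !laurent_coefMU subr0.
- by rewrite !mulr0 !add0r laurent_coefMU subr0 mulr1.
by rewrite mulr0 addr0 laurent_coefD !laurent_coefMU opprK.
Qed.

Lemma transfer_coef0 s t k : (0 < k) || (k < -1) -> (T s t)@_k = 0.
Proof.
move=> far.
have k0 : (0 == k) = false by apply/negbTE/eqP => k0; rewrite -k0 in far.
have k1 : (-1 == k) = false by apply/negbTE/eqP => k1; rewrite -k1 in far.
by rewrite mxE; case: s t => [[|[|[|s]]] ?] [[|[|[|t]]] ?] //=;
  rewrite ?laurent_coef0 // mcoeffU ?k0 ?k1.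
Qed.

(** As [t - s] lies between -2 and 2, the term [3 * (k - p)] decides the sign. *)
Lemma sgz_far (s t : 'I_3) (k p : int) : (0 < k) || (k < -1) ->
  (p == 0) || (p == -1) -> sgz (t%:Z - s%:Z + 3 * (k - p)) = sgz k.
Proof.
have := ltn_ord s; have := ltn_ord t => lt_t lt_s /orP[kp|kn] pP.
  by rewrite !gtr0_sgz //; lia.
by rewrite !ltr0_sgz //; lia.
Qed.

Lemma rmatrix_transfer_far P s t k : (0 < k) || (k < -1) ->
  ((rmatrix P * T) s t)@_k = ((P * T) s t)@_k *~ sgz k.
Proof.
move=> far; rewrite !mxE !raddf_sum mulrz_suml; apply: eq_bigr => u _ /=.
by rewrite [T u t]mxE; case: u t => [[|[|[|u]]] ltu] [[|[|[|t]]] ltt] //=;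
  rewrite ?mulr0 ?mcoeff0 ?mul0rz // !laurent_coefMU rmatrix_coef sgz_far //;
  rewrite mulrzAl.
Qed.

Lemma transfer_rmatrix_far P s t k : (0 < k) || (k < -1) ->
  ((T * rmatrix P) s t)@_k = ((T * P) s t)@_k *~ sgz k.
Proof.
move=> far; rewrite !mxE !raddf_sum mulrz_suml; apply: eq_bigr => u _ /=.
by rewrite [T s u]mxE; case: s u => [[|[|[|s]]] lts] [[|[|[|u]]] ltu] //=;
  rewrite ?mul0r ?mcoeff0 ?mul0rz // !laurent_coefUM rmatrix_coef sgz_far //;
  rewrite mulrzAr.
Qed.

Variables (h : F -> F) (S : 'M[laurent F]_3).
Hypothesis hD : {morph h : x y / x + y}.
Hypothesis hM : forall x y, h (x * y) = h x * y + x * h y.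

(** Remainders leaving the face through br ([p], [q]) or tr ([p'], [q']) and coming back to tl ([p],
    [p']) or bl ([q], [q']). The exponent 1 balances the -1 carried by the arrow out of tr. *)
Let p := (S strand1 strand1)@_0.
Let q := (S strand1 strand2)@_0.
Let p' := (S strand3 strand1)@_1.
Let q' := (S strand3 strand2)@_1.

Hypothesis flow : edge_flow h a b c d p q p' q'.

Lemma local_lax :
  map_derivation h T *+ 2 = rmatrix (T * S) * T - T * rmatrix (S * T).
Proof.
apply/matrixP => s t; apply: laurentP => k.
have mxD (A B : 'M[laurent F]_3) : ((A + B) s t)@_k = (A s t)@_k + (B s t)@_k.
  by rewrite mxE laurent_coefD.
have mxB (A B : 'M[laurent F]_3) : ((A - B) s t)@_k = (A s t)@_k - (B s t)@_k.
  by rewrite -laurent_coefB !mxE.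
rewrite mulr2n mxD mxB -mulr2n (map_derivation_coef _ _ _ _ (derivation0 hD)).
have [far|near] := boolP ((0 < k) || (k < -1)).
  (* In these degrees both terms are [sgz k] times the coefficient of [T * S * T]. *)
  rewrite rmatrix_transfer_far // transfer_rmatrix_far // mulrA subrr.
  by rewrite transfer_coef0 // (derivation0 hD) mul0rn.
have {near} : (k == 0) || (k == -1) by lia.

have Tr1 P u l := let: And3 e _ _ := transfer_mulr_coef P u l in e.
have Tr2 P u l := let: And3 _ e _ := transfer_mulr_coef P u l in e.
have Tr3 P u l := let: And3 _ _ e := transfer_mulr_coef P u l in e.
have Tl1 P u l := let: And3 e _ _ := transfer_mull_coef P u l in e.
have Tl2 P u l := let: And3 _ e _ := transfer_mull_coef P u l in e.
have Tl3 P u l := let: And3 _ _ e := transfer_mull_coef P u l in e.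
have [ha hb hc hd] := flow.
have h_dc : h (d * c) *+ 2 = (h d *+ 2) * c + d * (h c *+ 2).
  by rewrite hM mulrnDl mulrnAl mulrnAr.
have h_ad : h (a * d) *+ 2 = (h a *+ 2) * d + a * (h d *+ 2).
  by rewrite hM mulrnDl mulrnAl mulrnAr.
have h_badc : h (b + a * d * c) *+ 2 =
    h b *+ 2 + (h (a * d) *+ 2) * c + a * d * (h c *+ 2).
  by rewrite hD hM !mulrnDl mulrnAl mulrnAr addrA.
rewrite ha hd in h_ad; rewrite hc hd in h_dc; rewrite hb hc h_ad in h_badc.
(* Both sides are expanded in the coefficients of [S], the derivatives being given by [flow]; each
   case is then a polynomial identity. *)
case/orP=> /eqP->; case: (strandP s) => ->; case: (strandP t) => ->;
  rewrite [T _ _]mxE /= ?laurent_coef0 ?mcoeffU /= ?(derivation0 hD) ?mul0rn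
    ?(derivation1 hM) ?h_dc ?h_ad ?h_badc ?hd ?mul0rn;
  clearbody T; rewrite ?(Tr1, Tr2, Tr3, Tl1, Tl2, Tl3) !rmatrix_coef;
  rewrite ?(Tr1, Tr2, Tr3, Tl1, Tl2, Tl3) ?addNr ?add0r;
  eval_sgz; rewrite ?mulr1z ?mulrN1z ?mulr0z;
  Ncring_tac.non_commutative_ring.
Qed.

(** Behind and before the face stand the same diagonal coefficients of two consecutive rotations, so
    these equations telescope over the faces. *)
Lemma local_right_side :
  h (d * c) *+ 2 =
  d * c * ((S * T) strand1 strand1)@_0 - ((T * S) strand1 strand1)@_0 * (d * c).
Proof.
have [-> _ _] := transfer_mulr_coef S strand1 0.
have [-> _ _] := transfer_mull_coef S strand1 0.
have [_ _ hc hd] := flow.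
rewrite add0r hM mulrnDl -mulrnAl -mulrnAr hc hd.
Ncring_tac.non_commutative_ring.
Qed.

(** This one does not telescope, but in the products z_k an unpaired top side occurs only as the
    last factor. *)
Lemma local_top_side :
  h d *+ 2 =
  d * ((c * ((S * T) strand1 strand3)@_(-1)) *+ 2 + ((S * T) strand3 strand3)@_0)
  - ((T * S) strand1 strand1)@_0 * d.
Proof.
have [_ _ ->] := transfer_mulr_coef S strand1 (-1).
have [_ _ ->] := transfer_mulr_coef S strand3 0.
have [-> _ _] := transfer_mull_coef S strand1 0.
have [_ _ _ hd] := flow.
rewrite addNr add0r hd mulr2n.
Ncring_tac.non_commutative_ring.
Qed.

End LocalLax.

(** * Lax equations *)

Section MapDerivation.
Variables (F : nzRingType) (h : F -> F).
Hypothesis hD : {morph h : x y / x + y}.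
Hypothesis hM : forall x y, h (x * y) = h x * y + x * h y.
Let h0 := derivation0 hD.

Lemma derivation_sum (I : Type) (r : seq I) (P : pred I) (E : I -> F) :
  h (\sum_(i <- r | P i) E i) = \sum_(i <- r | P i) h (E i).
Proof. exact: (big_morph h hD h0). Qed.

Lemma laurent_map_derivationM (f g : laurent F) :
  laurent_map (fun=> h) (f * g) =
  laurent_map (fun=> h) f * g + f * laurent_map (fun=> h) g.
Proof.
apply: laurentP => k; rewrite laurent_coefD laurent_coef_map //.
have le_f : (msupp (laurent_map (fun=> h) f) `<=` msupp f)%fset.
  apply/fsubsetP => l; rewrite -!mcoeff_neq0 laurent_coef_map //.
  by apply: contra => /eqP->; rewrite h0.
rewrite (laurent_coefMw _ _ le_f) !laurent_coefM derivation_sum -big_split.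
by apply: eq_bigr => l _; rewrite hM !laurent_coef_map.
Qed.

Lemma map_derivationM (A B : 'M[laurent F]_3) :
  map_derivation h (A * B) = map_derivation h A * B + A * map_derivation h B.
Proof.
apply/matrixP => s t; apply: laurentP => k.
rewrite map_derivation_coef // [(A * B) _ _]mxE laurent_coef_sum derivation_sum.
rewrite [in RHS]mxE laurent_coefD [in X in X + _]mxE [in X in _ + X]mxE.
rewrite !laurent_coef_sum -big_split; apply: eq_bigr => u _ /=.
have := congr1 (mcoeff k) (laurent_map_derivationM (A s u) (B u t)).
by rewrite laurent_coef_map // laurent_coefD => ->; rewrite !mxE.
Qed.

Lemma map_derivation1 : map_derivation h (1 : 'M[laurent F]_3) = 0.
Proof.
have := map_derivationM 1 1; rewrite !mulr1 mul1r -[LHS]addr0.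
by move/addrI.
Qed.

End MapDerivation.

Section FormTransfer.
Variables (F : nzRingType) (V : zmodType) (psi : F -> F -> V).
Hypothesis psi_cyc : cyclic_form psi.

(** The words [d * c], [d], [b], [a * d * c], [a * d] are split into edges; each edge collects the
    remainders of all closed paths through it, nine terms in all. The entry 1 contributes
    nothing. *)
Lemma matrix_form_transfer (a b c d : F) (S : 'M[laurent F]_3) :
  let p := (S strand1 strand1)@_0 in let q := (S strand1 strand2)@_0 in
  let p' := (S strand3 strand1)@_1 in let q' := (S strand3 strand2)@_1 in
  matrix_form (laurent_form psi) (transfer a b c d) S =
  psi a (d * c * q + d * q') + psi b q + psi c (p * d + q * a * d) +
  psi d (c * p + p' + c * q * a + q' * a).
Proof.
move=> p q p' q'; have form_cyc := laurent_form_cyclic psi_cyc.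
rewrite /matrix_form !sum_strand !mxE /= !(cyclic0l form_cyc).
rewrite !laurent_formU // (cyclic1l psi_cyc) !oppr0 !opprK.
rewrite -/p -/q -/p' -/q' (cyclicDl psi_cyc) !(cyclicM psi_cyc).
rewrite !(cyclicDr psi_cyc) ?mulrA ?addr0 !addrA.
by rewrite [LHS](ACl (5 * 8 * 4 * 2 * 7 * 1 * 3 * 6 * 9)).
Qed.

End FormTransfer.

(** * Brackets with the weights of a face *)

Section NetworkBracket.
Variables (n : nat) (F : unitAlgType rat) (gen : generator n -> F).
Variable db : F -> F -> tensor F F.
Hypothesis hdb : network_bracket gen db.

Lemma loop_insertion_edge s t (i : 'Z_n) r :
  loop_insertion db (gen (t, i)) (gen (s, i)) r *+ 2 =
  let a := gen (Left, i) in let b := gen (Bottom, i) in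
  let c := gen (Right, i) in let d := gen (Top, i) in
  match s, t with
  | Bottom, Left => b * r * a   | Left, Bottom => - (a * r * b)
  | Bottom, Right => c * r * b  | Right, Bottom => - (b * r * c)
  | Left, Top => r * (a * d)    | Top, Left => - (a * d * r)
  | Right, Top => d * c * r     | Top, Right => - (r * (d * c))
  | _, _ => 0
  end.
Proof.
have insZ (u v : F) :
    tensor_mult ((2^-1 : rat) *: (u \ox v) * (r \ox 1)) *+ 2 = u * r * v.
  rewrite -tensZl tens_mul tensor_mult_tens mulr1 -!scalerAl -scaler_nat.
  by rewrite scalerA divff // scale1r.
have insZN (u v : F) :
    tensor_mult (- ((2^-1 : rat) *: (u \ox v)) * (r \ox 1)) *+ 2 =
    - (u * r * v).
  by rewrite mulNr tensor_multN mulNrn insZ.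
rewrite /loop_insertion hdb.2 eqxx.
by case: s t => [] [] /=;
  rewrite ?tensor_flipZ ?tensor_flip0 ?tensor_flip_tens ?subr0 ?sub0r
    ?insZ ?insZN ?mulrA ?mulr1 ?mul1r // mul0r tensor_mult0 mul0rn.
Qed.

Variable idx : nat -> 'Z_n.
Hypothesis idx_inj : forall k l, (k < n)%N -> (l < n)%N -> idx k = idx l -> k = l.

(** Brackets between distinct faces vanish, so on the weights of the face [m] only the [m]-th
    summand survives. *)
Lemma network_flow (x : F) (S : nat -> 'M[laurent F]_3) :
  (forall y, tensor_mult (db x y) = \sum_(0 <= m < n)
     matrix_form (laurent_form (loop_insertion db y))
       (transfer (gen (Left, idx m)) (gen (Bottom, idx m))
          (gen (Right, idx m)) (gen (Top, idx m))) (S m)) ->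
  forall m, (m < n)%N ->
    edge_flow (fun y => tensor_mult (db x y)) (gen (Left, idx m))
      (gen (Bottom, idx m)) (gen (Right, idx m)) (gen (Top, idx m))
      (S m strand1 strand1)@_0 (S m strand1 strand2)@_0
      (S m strand3 strand1)@_1 (S m strand3 strand2)@_1.
Proof.
move=> hx m ltmn.
have ins0 s t l r : (l < n)%N -> l != m ->
    loop_insertion db (gen (t, idx m)) (gen (s, idx l)) r = 0.
  move=> ltl /eqP lm; rewrite /loop_insertion hdb.2.
  case: eqP => [/(idx_inj ltl ltmn)//|_].
  by rewrite mul0r tensor_mult0.
have hxm t : tensor_mult (db x (gen (t, idx m))) =
    matrix_form (laurent_form (loop_insertion db (gen (t, idx m))))
      (transfer (gen (Left, idx m)) (gen (Bottom, idx m))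
         (gen (Right, idx m)) (gen (Top, idx m))) (S m).
  rewrite hx (bigD1_seq m) ?iota_uniq ?mem_index_iota //= big_seq_cond big1.
    by rewrite addr0.
  move=> l /andP[]; rewrite mem_index_iota => /andP[_ ltl] lm.
  rewrite (matrix_form_transfer (loop_insertion_cyclic hdb.1 _)).
  by rewrite !ins0 // !addr0.
by split; rewrite hxm (matrix_form_transfer (loop_insertion_cyclic hdb.1 _))
  !mulrnDl !loop_insertion_edge /= ?add0r ?addr0 ?mulrA //.
Qed.

End NetworkBracket.

Section Rotation.
Variables (R : pzRingType) (T : nat -> R) (n : nat) (C : R).

(** With [C] standing for the remaining turns, this is i times the P_m of the overview. It is the
    product of [T m] and [remainder m] in one order, and of [T m.-1] and [remainder m.-1] in the
    other. *)
Definition rotation m := (\prod_(m <= j < n) T j) * C * \prod_(0 <= j < m) T j.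

Definition remainder m :=
  (\prod_(m.+1 <= j < n) T j) * C * \prod_(0 <= j < m) T j.

Lemma mul_remainder m : (m < n)%N -> T m * remainder m = rotation m.
Proof. by move=> ltmn; rewrite /rotation (big_ltn ltmn) !mulrA. Qed.

Lemma remainder_mul m : remainder m * T m = rotation m.+1.
Proof. by rewrite /rotation big_nat_recr //= mulrA. Qed.

End Rotation.

Section GlobalLax.
Variables (F : nzRingType) (h : F -> F).
Hypothesis hD : {morph h : x y / x + y}.
Hypothesis hM : forall x y, h (x * y) = h x * y + x * h y.
Variables (n : nat) (a b c d : nat -> F) (T P S : nat -> 'M[laurent F]_3).
Hypothesis TE : forall m, T m = transfer (a m) (b m) (c m) (d m).
Hypothesis TS : forall m, (m < n)%N -> T m * S m = P m.
Hypothesis ST : forall m, S m * T m = P m.+1.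
Let w m := \prod_(0 <= j < m) (d j * c j).

Hypothesis flow : forall m, (m < n)%N ->
  edge_flow h (a m) (b m) (c m) (d m)
    (S m strand1 strand1)@_0 (S m strand1 strand2)@_0
    (S m strand3 strand1)@_1 (S m strand3 strand2)@_1.

Lemma transfer_lax m : (m < n)%N ->
  map_derivation h (T m) *+ 2 = rmatrix (P m) * T m - T m * rmatrix (P m.+1).
Proof.
move=> ltmn; have := local_lax hD hM (flow ltmn).
rewrite -TE (TS ltmn) ST => lax; exact: lax.
Qed.

Lemma prefix_lax m : (m <= n)%N ->
  map_derivation h (\prod_(0 <= j < m) T j) *+ 2 =
  rmatrix (P 0) * (\prod_(0 <= j < m) T j)
  - (\prod_(0 <= j < m) T j) * rmatrix (P m).
Proof.
elim: m => [|m IH] lemn.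
  by rewrite big_geq // mulr1 mul1r subrr (map_derivation1 hD hM) mul0rn.
rewrite (@big_nat_recr _ _ _ m) //=; move: (\prod_(0 <= j < m) T j) IH => V IH.
rewrite (map_derivationM hD hM) mulrnDl -mulrnAl -mulrnAr (IH (ltnW lemn)).
rewrite (transfer_lax lemn).
move: (rmatrix (P 0)) (rmatrix (P m)) (rmatrix (P m.+1)) => R0 R1 R2.
rewrite mulrBl mulrBr !mulrA addrA subrK; reflexivity.
Qed.

Lemma right_sides_flow m : (m <= n)%N ->
  h (w m) *+ 2 =
  w m * (P m strand1 strand1)@_0 - (P 0 strand1 strand1)@_0 * w m.
Proof.
elim: m => [|m IH] lemn.
  by rewrite /w big_geq // mulr1 mul1r subrr (derivation1 hM) mul0rn.
rewrite /w big_nat_recr //= -/(w m) hM mulrnDl -mulrnAl -mulrnAr.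
have := local_right_side hM (flow lemn).
rewrite -TE (TS lemn) ST => ->; rewrite (IH (ltnW lemn)).
by rewrite mulrBl mulrBr !mulrA addrC addrA subrK.
Qed.

Lemma top_sides_flow m : (m < n)%N ->
  h (w m * d m) *+ 2 =
  w m * d m * ((c m * (P m.+1 strand1 strand3)@_(-1)) *+ 2
               + (P m.+1 strand3 strand3)@_0)
  - (P 0 strand1 strand1)@_0 * (w m * d m).
Proof.
move=> ltmn; rewrite hM mulrnDl -[h _ * _ *+ 2]mulrnAl -[_ * h _ *+ 2]mulrnAr.
have := local_top_side (flow ltmn).
rewrite -TE (TS ltmn) ST => ->.
rewrite (right_sides_flow (ltnW ltmn)).
by rewrite mulrBl mulrBr !mulrA addrC addrA subrK.
Qed.

End GlobalLax.

(** * Paths in the network *)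

Section TupleSum.
Variables (T : finType) (V : nmodType).

Lemma sum_tuple0 (P : pred (seq T)) (E : seq T -> V) :
  \sum_(p : 0.-tuple T | P p) E p = if P [::] then E [::] else 0.
Proof.
rewrite big_mkcond (bigD1 [tuple]) //= big1 ?addr0 // => p /eqP[].
exact: tuple0.
Qed.

Lemma sum_tupleS m (P : pred (seq T)) (E : seq T -> V) :
  \sum_(p : m.+1.-tuple T | P p) E p =
  \sum_x \sum_(p : m.-tuple T | P (x :: p)) E (x :: p).
Proof.
rewrite pair_big_dep /=.
rewrite (reindex (fun q : T * m.-tuple T => [tuple of q.1 :: q.2])) //=.
exists (fun p : m.+1.-tuple T => (thead p, [tuple of behead p])) => [[x p]|p] _.
  by rewrite theadE; congr (_, _); apply: val_inj.
by rewrite /= -tuple_eta.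
Qed.

End TupleSum.

Section PathSums.
Variables (n : nat) (F : nzRingType) (X Y : nat -> F) (Z : F).
Implicit Types u v : vertex n.

Let step u v := modified_weight X Y Z u v.

Definition walk_sum m u v : laurent F :=
  \sum_(p : m.-tuple (vertex n) | path (@arrow n) u p && (last u p == v))
    path_weight X Y Z u p.

Definition path_sum u v : laurent F := \sum_(m < #|{: vertex n}|) walk_sum m u v.

Lemma walk_sum0 u v : walk_sum 0 u v = (u == v)%:R.
Proof.
rewrite /walk_sum (sum_tuple0 (fun p => path (@arrow n) u p && (last u p == v))).
by rewrite /=; case: eqP.
Qed.

Lemma walk_sumS m u v :
  walk_sum m.+1 u v = \sum_(x | arrow u x) step u x * walk_sum m x v.
Proof.
rewrite /walk_sum (sum_tupleS m (fun p => path (@arrow n) u p && (last u p == v))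
  (path_weight X Y Z u)) [RHS]big_mkcond /=.
apply: eq_bigr => x _; case: (arrow u x) => /=; last exact: big_pred0.
by rewrite mulr_sumr.
Qed.

Lemma walk_sum_large m u v : (#|{: vertex n}| <= m)%N -> walk_sum m u v = 0.
Proof.
move=> le_m; apply: big_pred0 => p; apply/negbTE/negP => /andP[/directed_path_size].
by rewrite size_tuple ltnNge le_m.
Qed.

Lemma path_sum_step u v :
  path_sum u v = (u == v)%:R + \sum_(x | arrow u x) step u x * path_sum x v.
Proof.
(* The additional length contributes nothing, as the network is acyclic, and makes room for
   splitting off the first arrow. *)
have -> : path_sum u v = \sum_(m < #|{: vertex n}|.+1) walk_sum m u v.
  by rewrite big_ord_recr /= walk_sum_large // addr0.
rewrite big_ord_recl walk_sum0; congr (_ + _).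
under eq_bigr => m _ do rewrite walk_sumS.
by rewrite exchange_big; apply: eq_bigr => x _; rewrite mulr_sumr.
Qed.

Lemma path_sum_next u v (s : seq (vertex n)) : uniq s -> arrow u =i s ->
  path_sum u v = (u == v)%:R + \sum_(x <- s) step u x * path_sum x v.
Proof. by move=> us su; rewrite path_sum_step (eq_bigl _ _ su) -big_uniq. Qed.

(* Faces are counted from 0 here. *)
Definition top_left k : vertex n :=
  oapp (Corner TL) (Sink strand1) (insub k).

(** Continuing the numbering of faces by the sinks, at [n] for sinks 1 and 2 and at [n.+1] for sink
    3, makes the last faces obey the same recursion as the others. *)
Definition bottom_left k : vertex n :=
  oapp (Corner BL) (Sink (if k == n then strand2 else strand3)) (insub k).

Lemma top_left_ord (j : 'I_n) : top_left j = Corner TL j.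
Proof. by rewrite /top_left valK. Qed.

Lemma top_left_end : top_left n = Sink strand1.
Proof. by rewrite /top_left insubF ?ltnn. Qed.

Lemma bottom_left_ord (j : 'I_n) : bottom_left j = Corner BL j.
Proof. by rewrite /bottom_left valK. Qed.

Lemma bottom_left_end : bottom_left n = Sink strand2.
Proof. by rewrite /bottom_left insubF ?ltnn // eqxx. Qed.

Lemma bottom_left_end2 : bottom_left n.+1 = Sink strand3.
Proof. by rewrite /bottom_left insubF ?ltnNge ?leqnSn // gtn_eqF. Qed.

Lemma next_BL (i : 'I_n) : arrow (Corner BL i) =i [:: Corner TL i; Corner BR i].
Proof.
move=> x; rewrite unfold_in !inE; apply/idP/orP => [|[]/eqP->] /=; last 2 first.
- exact: eqxx.
- exact: eqxx.
by case: x => [s|s|[] j] //= /eqP<-; [left | right].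
Qed.

Lemma next_TL (i : 'I_n) : arrow (Corner TL i) =i [:: Corner TR i].
Proof.
move=> x; rewrite unfold_in !inE; apply/idP/eqP => [|->] /=; last exact: eqxx.
by case: x => [s|s|[] j] //= /eqP<-.
Qed.

Lemma next_BR (i : 'I_n) : arrow (Corner BR i) =i [:: top_left i.+1].
Proof.
move=> x; rewrite unfold_in !inE; apply/idP/eqP => [|->] /=.
  case: x => [s|s|[] j] //=.
    rewrite /num => /andP[/eqP[s0] /eqP->]; rewrite top_left_end.
    by congr Sink; apply: val_inj.
  by rewrite /num addn1 => /eqP[<-]; rewrite top_left_ord.
have [lt_in|] := ltnP i.+1 n.
  by rewrite -[i.+1]/(val (Ordinal lt_in)) top_left_ord /num /= addn1.
rewrite leq_eqVlt ltnS leqNgt ltn_ord orbF => /eqP n_eq.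
by rewrite -n_eq top_left_end /num /= -n_eq eqxx.
Qed.

Lemma next_TR (i : 'I_n) :
  arrow (Corner TR i) =i [:: Corner BR i; bottom_left i.+2].
Proof.
move=> x; rewrite unfold_in !inE; apply/idP/orP => [|[]/eqP->] /=; last 2 first.
- exact: eqxx.
- have [lt_in|] := ltnP i.+2 n.
    by rewrite -[i.+2]/(val (Ordinal lt_in)) bottom_left_ord /num /= addn2.
  have := ltn_ord i; rewrite leq_eqVlt => /orP[/eqP in1 _|].
    by rewrite -[X in bottom_left X.+1]/(i.+1) in1 bottom_left_end2 /num /= in1 eqxx ?orbT.
  move=> lt1 le2; have -> : i.+2 = n by lia.
  by rewrite bottom_left_end /num /=; apply/orP; left; lia.
case: x => [s|s|[] j] //=.
- move=> Hs; right; apply/eqP; have ltn := ltn_ord i.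
  case/orP: Hs; rewrite /num => /andP[/eqP[s1] /eqP i1].
    have -> : i.+2 = n by lia.
    by rewrite bottom_left_end; congr Sink; apply: val_inj.
  by rewrite i1 bottom_left_end2; congr Sink; apply: val_inj.
- by rewrite /num addn2 => /eqP[<-]; right; rewrite bottom_left_ord.
by move=> /eqP<-; left.
Qed.

Lemma path_sum_corner x i t s : uniq s -> arrow (Corner x i) =i s ->
  path_sum (Corner x i) (Sink t) =
  \sum_(v <- s) step (Corner x i) v * path_sum v (Sink t).
Proof.
by move=> us su; rewrite (path_sum_next _ us su) (_ : _ == _ = false) ?add0r.
Qed.

(** Along an arrow, [crossing] is the increase of this function, except on the arrows leaving tr for
    bl or a sink, where it is one less. A single value serves all three sinks thanks to [rim_turn];
    it is the power of lambda split off from B. *)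
Definition potential (v : vertex n) : nat :=
  match v with
  | Source _ => 0
  | Corner _ i => num i %/ 3
  | Sink _ => n.+1 %/ 3
  end.

Lemma crossing_BR (i : 'I_n) :
  (potential (Corner BR i))%:Z + crossing (Corner BR i) (top_left i.+1) =
  (potential (top_left i.+1))%:Z.
Proof.
have [lt_in|] := ltnP i.+1 n.
  rewrite -[i.+1]/(val (Ordinal lt_in)) top_left_ord /= /num /=.
  by case: ifP; lia.
rewrite leq_eqVlt ltnS leqNgt ltn_ord orbF => /eqP n_eq.
rewrite -n_eq top_left_end /= /rim_turn /num /=.
by case E: (n %% 3)%N => [|[|[|r]]]; rewrite /=; lia.
Qed.

Lemma crossing_TR (i : 'I_n) :
  (potential (Corner TR i))%:Z + crossing (Corner TR i) (bottom_left i.+2) =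
  (potential (bottom_left i.+2))%:Z - 1.
Proof.
have [lt_in|] := ltnP i.+2 n.
  rewrite -[i.+2]/(val (Ordinal lt_in)) bottom_left_ord /= /num /=.
  by case: ifP; lia.
have := ltn_ord i; rewrite leq_eqVlt => /orP[/eqP in1 _|lt1 le2].
  rewrite -[X in bottom_left X.+1]/(i.+1) in1 bottom_left_end2 /= /rim_turn /num /=.
  by case E: (n %% 3)%N => [|[|[|r]]]; rewrite /=; case: ifP; lia.
have -> : i.+2 = n by lia.
rewrite bottom_left_end /= /rim_turn /num /=.
by case E: (n %% 3)%N => [|[|[|r]]]; rewrite /=; case: ifP; lia.
Qed.

(* Moves the exponents of [lambda] to the arrows tr_i -> bl_(i+2). *)
Definition gauged_sum v (t : 'I_3) : laurent F :=
  laurent_monomial (if v is Sink _ then Z else 1) (potential v)%:Z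
  * path_sum v (Sink t).

(** The weight [Z] of an arrow into a sink is counted in the [gauged_sum] of the sink, so the arrow
    itself keeps weight 1. *)
Lemma gauged_step (x : corner) (i : 'I_n) v k t :
  (potential (Corner x i))%:Z + crossing (Corner x i) v = (potential v)%:Z + k ->
  laurent_monomial 1 (potential (Corner x i))%:Z
    * (step (Corner x i) v * path_sum v (Sink t)) =
  laurent_monomial (if v is Sink _ then 1 else weight X Y Z (Corner x i) v) k
    * gauged_sum v t.
Proof.
move=> vk; rewrite /gauged_sum !mulrA /step /modified_weight !laurent_monomialM.
rewrite vk [in RHS]addrC mul1r; case: v vk => [s|s|y j] vk; rewrite ?mulr1 //.
by case: x vk => vk; rewrite mul1r.
Qed.

Lemma gauged_sum_TL i t : gauged_sum (Corner TL i) t = gauged_sum (Corner TR i) t.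
Proof.
rewrite {1}/gauged_sum (path_sum_corner _ _ (next_TL i)) // big_seq1.
by rewrite (@gauged_step TL i (Corner TR i) 0 t erefl) mul1r.
Qed.

Lemma gauged_sum_BL i t : gauged_sum (Corner BL i) t =
  laurent_monomial (X (num i)) 0 * gauged_sum (Corner TL i) t
  + laurent_monomial (Y (num i)) 0 * gauged_sum (Corner BR i) t.
Proof.
rewrite {1}/gauged_sum (path_sum_corner _ _ (next_BL i)); last first.
  by rewrite /= inE; case: eqP.
rewrite big_cons big_seq1 mulrDr.
by rewrite (@gauged_step BL i (Corner TL i) 0 t erefl)
  (@gauged_step BL i (Corner BR i) 0 t erefl).
Qed.

Lemma gauged_sum_BR i t :
  gauged_sum (Corner BR i) t = gauged_sum (top_left i.+1) t.
Proof.
rewrite {1}/gauged_sum (path_sum_corner _ _ (next_BR i)) // big_seq1.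
have cr := crossing_BR i; rewrite -[RHS]addr0 in cr.
rewrite (@gauged_step BR i (top_left i.+1) 0 t cr).
by rewrite /top_left; case: insub => [j|] /=; rewrite mul1r.
Qed.

Lemma gauged_sum_TR i t : gauged_sum (Corner TR i) t =
  gauged_sum (Corner BR i) t
  + laurent_monomial 1 (-1) * gauged_sum (bottom_left i.+2) t.
Proof.
rewrite {1}/gauged_sum (path_sum_corner _ _ (next_TR i)); last first.
  by rewrite /= inE /bottom_left; case: insub => [j|]; case: eqP.
rewrite big_cons big_seq1 mulrDr (@gauged_step TR i (Corner BR i) 0 t erefl) mul1r.
rewrite (@gauged_step TR i (bottom_left i.+2) (-1) t (crossing_TR i)).
by rewrite /bottom_left; case: insub => [j|].
Qed.

Lemma gauged_sum_Sink s t :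
  gauged_sum (Sink s) t = laurent_monomial Z (n.+1 %/ 3)%:Z *+ (s == t).
Proof.
rewrite /gauged_sum path_sum_step big_pred0 // addr0 -[RHS]mulr_natr.
congr (_ * (nat_of_bool _)%:R); apply/eqP/eqP => [[]//|->//].
Qed.

Definition slice k (s : 'I_3) : vertex n :=
  match val s with
  | 0%N => top_left k
  | 1%N => bottom_left k
  | _ => bottom_left k.+1
  end.

Definition slice_sums k : 'M[laurent F]_3 :=
  \matrix_(s, t) gauged_sum (slice k s) t.

(** From tr_k a path goes on through br_k to the next tl, or to the second next bl. The third strand
    bypasses the face, which gives the entry 1 of [transfer]. *)
Lemma slice_sums_step k : (k < n)%N ->
  slice_sums k = transfer (X k.+1) (Y k.+1) 1 1 * slice_sums k.+1.
Proof.
move=> ltkn; pose i := Ordinal ltkn.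
have TR_sum t : gauged_sum (Corner TR i) t =
    slice_sums k.+1 strand1 t
    + laurent_monomial 1 (-1) * slice_sums k.+1 strand3 t.
  by rewrite gauged_sum_TR gauged_sum_BR !mxE.
have BR_sum t : gauged_sum (Corner BR i) t = slice_sums k.+1 strand1 t.
  by rewrite gauged_sum_BR mxE.
have TL_i : top_left k = Corner TL i := top_left_ord i.
have BL_i : bottom_left k = Corner BL i := bottom_left_ord i.
apply/matrixP => s t; rewrite [RHS]mxE sum_strand [LHS]mxE /slice.
rewrite ![transfer _ _ _ _ s _]mxE !mulr1.
case: (strandP s) => -> /=; rewrite ?mul0r ?add0r ?addr0.
- by rewrite TL_i gauged_sum_TL TR_sum mul1r.
- rewrite BL_i gauged_sum_BL gauged_sum_TL TR_sum BR_sum.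
  rewrite laurent_monomialD mulrDl mulrDr mulrA laurent_monomialM mulr1 add0r.
  have -> : num i = k.+1 := erefl.
  by rewrite [LHS]addrC addrA.
by rewrite mxE mul1r.
Qed.

Lemma slice_sums_end : slice_sums n = (laurent_monomial Z (n.+1 %/ 3)%:Z)%:M.
Proof.
apply/matrixP => s t; rewrite !mxE /slice.
by case: (strandP s) => -> /=;
  rewrite ?top_left_end ?bottom_left_end ?bottom_left_end2 gauged_sum_Sink.
Qed.

Lemma slice_sums_prod k : (k <= n)%N ->
  slice_sums k = (\prod_(k <= j < n) transfer (X j.+1) (Y j.+1) 1 1)
                 * (laurent_monomial Z (n.+1 %/ 3)%:Z)%:M.
Proof.
(* Descending induction on [k], starting from the sinks. *)
move=> lekn; rewrite -(subKn lekn); elim: (n - k)%N (leq_subr k n) => [|m IH] lemn.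
  by rewrite subn0 big_geq // mul1r slice_sums_end.
have lt_mn : (n - m.+1 < n)%N by lia.
have n_m : (n - m.+1).+1 = (n - m)%N by lia.
by rewrite (slice_sums_step lt_mn) (big_ltn lt_mn) n_m (IH (ltnW lemn)) mulrA.
Qed.

Hypothesis hn : (1 < n)%N.

Lemma boundary_measurement_prod :
  boundary_measurement n X Y Z =
  (\prod_(0 <= j < n) transfer (X j.+1) (Y j.+1) 1 1)
  * (laurent_monomial Z (n.+1 %/ 3)%:Z)%:M.
Proof.
rewrite -slice_sums_prod //; apply/matrixP => s t; rewrite !mxE.
(* Source 3 enters the second face, which exists since [1 < n]. *)
pose i0 := Ordinal (ltnW hn); pose i1 := Ordinal hn.
have TL0 : top_left 0 = Corner TL i0 := top_left_ord i0.
have BL0 : bottom_left 0 = Corner BL i0 := bottom_left_ord i0.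
have BL1 : bottom_left 1 = Corner BL i1 := bottom_left_ord i1.
have next_source : arrow (Source s) =i [:: slice 0 s].
  move=> x; rewrite unfold_in !inE /slice.
  case: (strandP s) => -> /=; rewrite ?TL0 ?BL0 ?BL1;
    apply/idP/eqP => [|-> //]; case: x => [r|r|[] j] //=; rewrite /num /=.
  - by move=> /eqP[j0]; congr Corner; apply: val_inj.
  - by rewrite orbF => /eqP[j0]; congr Corner; apply: val_inj.
  by move=> /eqP[j0]; congr Corner; apply: val_inj.
rewrite -[LHS]/(path_sum (Source s) (Sink t)).
rewrite (path_sum_next _ _ next_source) // add0r big_seq1 /gauged_sum /slice.
by case: (strandP s) => -> /=; rewrite ?TL0 ?BL0 ?BL1.
Qed.

End PathSums.

(** * Conjugation and coefficients *)

Section LaxConjugation.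
Variables (R : pzRingType) (D : R -> R).
Hypothesis DM : forall x y, D (x * y) = D x * y + x * D y.

(** Gauge transformation of a Lax pair: differentiating [y * g = g * x] adds the logarithmic
    derivative of [g]. *)
Lemma lax_conj g g' x y r : g * g' = 1 -> g' * g = 1 -> y * g = g * x ->
  D x *+ 2 = r * x - x * r ->
  let m := g * r * g' + D g *+ 2 * g' in D y *+ 2 = m * y - y * m.
Proof.
move=> gg' g'g yg Dx m.
have Dyg : D y *+ 2 * g = D g *+ 2 * x + g * (r * x - x * r) - y * (D g *+ 2).
  have := congr1 (fun z => D z *+ 2) yg; rewrite /= !DM !mulrnDl.
  by rewrite -!(mulrnAl (D _)) -(mulrnAr g) -(mulrnAr y) Dx => <-; rewrite addrK.
have g'y : g' * y = x * g' by rewrite -[y]mulr1 -gg' (mulrA y) yg !mulrA g'g mul1r.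
have my : m * y = g * r * x * g' + D g *+ 2 * x * g'.
  by rewrite /m mulrDl -!mulrA g'y !mulrA.
have ym : y * m = g * x * r * g' + y * (D g *+ 2) * g'.
  by rewrite /m mulrDr !mulrA yg.
rewrite -[LHS]mulr1 -gg' mulrA Dyg my ym mulrBl mulrDl mulrBr mulrBl !mulrA opprD.
by rewrite !addrA; congr (_ - _ - _); rewrite addrC.
Qed.

Lemma laxX m y : D y *+ 2 = m * y - y * m ->
  forall j, D (y ^+ j) *+ 2 = m * y ^+ j - y ^+ j * m.
Proof.
move=> Dy; elim=> [|j IH]; first by rewrite mulr1 mul1r subrr (derivation1 DM) mul0rn.
rewrite exprS DM mulrnDl -mulrnAl -mulrnAr Dy IH mulrBl mulrBr !mulrA.
by rewrite addrA subrK.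
Qed.

End LaxConjugation.

Lemma prod_gauge (R : pzRingType) (T T' G : nat -> R) n :
  (forall m, (m < n)%N -> T' m * G m.+1 = G m * T m) ->
  (\prod_(0 <= j < n) T' j) * G n = G 0 * \prod_(0 <= j < n) T j.
Proof.
elim: n => [|n IH] TG; first by rewrite !big_geq // mulr1 mul1r.
rewrite !big_nat_recr //= -mulrA TG // !mulrA IH // => m ltmn.
exact/TG/ltnW.
Qed.

Section Gauge.
Variable F : nzRingType.

Definition strand_fun (x y z : F) (s : 'I_3) : F :=
  match val s with 0%N => x | 1%N => y | _ => z end.

Definition gauge (g : 'I_3 -> F) : 'M[laurent F]_3 :=
  diag_mx (\row_s laurent_monomial (g s) 0).

Lemma gauge_mulE g (A : 'M[laurent F]_3) s t :
  (gauge g * A) s t = laurent_monomial (g s) 0 * A s t.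
Proof. by rewrite -[gauge g * A]/(gauge g *m A) mul_diag_mx !mxE. Qed.

Lemma mul_gaugeE g (A : 'M[laurent F]_3) s t :
  (A * gauge g) s t = A s t * laurent_monomial (g t) 0.
Proof. by rewrite -[A * gauge g]/(A *m gauge g) mul_mx_diag !mxE. Qed.

Lemma gauge_coef g g' (A : 'M[laurent F]_3) s t k :
  ((gauge g * A * gauge g') s t)@_k = g s * (A s t)@_k * g' t.
Proof. by rewrite mul_gaugeE gauge_mulE laurent_coefMU laurent_coefUM !subr0. Qed.

Lemma gaugeV g g' : (forall s, g s * g' s = 1) -> gauge g * gauge g' = 1.
Proof.
move=> gg'; apply/matrixP => s t; rewrite gauge_mulE !mxE.
case: eqP => _; last by rewrite !mulr0n mulr0.
by rewrite !mulr1n laurent_monomialM gg' addr0.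
Qed.

(** Diagonal matrices free of lambda have degree 0 in the principal grading. *)
Lemma rmatrix_gauge g g' P :
  gauge g * rmatrix P * gauge g' = rmatrix (gauge g * P * gauge g').
Proof.
apply/matrixP => s t; apply: laurentP => k.
by rewrite rmatrix_coef !gauge_coef rmatrix_coef mulrzAr mulrzAl.
Qed.

(** Here [w] and [w'] are the gauge factors of tl of this face and the next, and [x], [y], [y']
    those of three consecutive bl. The last two hypotheses make the right and top weights equal to
    1. *)
Lemma gauge_transfer (X Y a b c d w w' x y y' : F) :
  X * w = x * a -> Y * w' = x * b -> w' = w * (d * c) -> y' = w * d ->
  transfer X Y 1 1 * gauge (strand_fun w' y y') =
  gauge (strand_fun w x y) * transfer a b c d.
Proof.
move=> Xw Yw w'E y'E; apply/matrixP => s t; rewrite gauge_mulE mul_gaugeE.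
rewrite !mxE; case: (strandP s) => ->; case: (strandP t) => -> /=;
  rewrite /strand_fun /= ?mulr0 ?mul0r // !laurent_monomialM ?mulr1 ?mul1r //.
- by rewrite w'E.
- by rewrite y'E.
- rewrite mulrDl Yw w'E mulrA Xw mulrDr; congr (laurent_monomial _ _).
  by rewrite !mulrA.
by rewrite y'E !mulrA Xw.
Qed.

End Gauge.

Section Coefficients.
Variables (F : nzRingType) (L : {pred F}).
Hypothesis L_subring : subring_closed L.

Let L1 : 1 \in L. Proof. by case: L_subring. Qed.
Let LB : {in L &, forall x y, x - y \in L}. Proof. by case: L_subring. Qed.
Let LM : {in L &, forall x y, x * y \in L}. Proof. by case: L_subring. Qed.
Let L0 : 0 \in L. Proof. by rewrite -(subrr 1) LB. Qed.
Let LD : {in L &, forall x y, x + y \in L}.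
Proof.
by move=> x y Lx Ly; rewrite -[y]opprK -[- y]sub0r LB ?LB.
Qed.

Definition coef_in (A : 'M[laurent F]_3) : Prop :=
  forall s t k, (A s t)@_k \in L.

Lemma sum_in (I : eqType) (r : seq I) (P : pred I) (E : I -> F) :
  (forall i, P i -> E i \in L) -> \sum_(i <- r | P i) E i \in L.
Proof. by move=> EL; elim/big_ind: _. Qed.

Lemma coef_inD A B : coef_in A -> coef_in B -> coef_in (A + B).
Proof. by move=> AL BL s t k; rewrite mxE laurent_coefD LD. Qed.

Lemma coef_inM A B : coef_in A -> coef_in B -> coef_in (A * B).
Proof.
move=> AL BL s t k; rewrite mxE laurent_coef_sum; apply: sum_in => u _.
by rewrite laurent_coefM; apply: sum_in => p _; apply: LM.
Qed.

Lemma coef_in1 : coef_in 1.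
Proof.
move=> s t k; rewrite mxE; case: eqP => _; rewrite ?mulr0n ?mulr1n ?laurent_coef0 //.
by rewrite mcoeffU; case: eqP.
Qed.

Lemma coef_inX A i : coef_in A -> coef_in (A ^+ i).
Proof.
by move=> AL; elim: i => [|i IH]; rewrite ?exprS; [apply: coef_in1 | apply: coef_inM].
Qed.

Lemma coef_in_scalar x k : x \in L -> coef_in (laurent_monomial x k)%:M.
Proof.
move=> xL s t l; rewrite !mxE; case: eqP => _; rewrite ?mulr0n ?mulr1n ?laurent_coef0 //.
by rewrite mcoeffU; case: eqP.
Qed.

Lemma coef_in_transfer a b c d :
  a \in L -> b \in L -> c \in L -> d \in L -> coef_in (transfer a b c d).
Proof.
move=> aL bL cL dL s t k; rewrite mxE.
by case: (strandP s) => ->; case: (strandP t) => -> /=;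
  rewrite ?laurent_coef0 // mcoeffU; case: eqP => _ //; rewrite ?mulr1n //;
  repeat first [apply: LM => // | apply: LD => //].
Qed.

Lemma mulrz_in x m : x \in L -> x *~ m \in L.
Proof.
move=> xL; have nat_in p : x *+ p \in L.
  by elim: p => [|p IH]; rewrite ?mulr0n // mulrS LD.
case: m => p; first by rewrite -pmulrn.
by rewrite NegzE mulrNz -pmulrn -sub0r LB.
Qed.

Lemma coef_in_mulrn A m : coef_in A -> coef_in (A *+ m).
Proof.
move=> AL; elim: m => [|m IH]; last by rewrite mulrS; apply: coef_inD.
by move=> s t k; rewrite mulr0n mxE laurent_coef0.
Qed.

Lemma coef_in_rmatrix A : coef_in A -> coef_in (rmatrix A).
Proof. by move=> AL s t k; rewrite rmatrix_coef mulrz_in. Qed.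

End Coefficients.

Section TraceCommutator.
Variables (F : nzRingType) (L S : {pred F}).
Hypothesis S_zmod : zmod_closed S.
Hypothesis S_comm : {in L &, forall x y, x * y - y * x \in S}.

Lemma laurent_coefM_supp_r (f g : laurent F) k :
  (f * g)@_k = \sum_(p <- msupp g) f@_(k - p) * g@_p.
Proof.
rewrite {1}(laurentE g) mulr_sumr laurent_coef_sum.
by apply: eq_bigr => p _; rewrite laurent_coefMU.
Qed.

Lemma mxtrace_commutator_in (A B : 'M[laurent F]_3) k :
  coef_in L A -> coef_in L B -> (\tr (A * B - B * A))@_k \in S.
Proof.
move=> AL BL; have [S0 SB] := S_zmod.
have SD : {in S &, forall x y, x + y \in S}.
  by move=> x y Sx Sy; rewrite -[y]opprK -[- y]sub0r SB ?SB.
rewrite raddfB /= laurent_coefB.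
(* Both traces are summed over the exponents of [A s t], so that they match term by term. *)
have -> : (\tr (B * A))@_k =
    \sum_s \sum_t \sum_(p <- msupp (A s t)) (B t s)@_(k - p) * (A s t)@_p.
  rewrite laurent_coef_sum exchange_big; apply: eq_bigr => t _.
  rewrite mxE laurent_coef_sum; apply: eq_bigr => s _.
  exact: laurent_coefM_supp_r.
have -> : (\tr (A * B))@_k =
    \sum_s \sum_t \sum_(p <- msupp (A s t)) (A s t)@_p * (B t s)@_(k - p).
  rewrite laurent_coef_sum; apply: eq_bigr => s _.
  rewrite mxE laurent_coef_sum; apply: eq_bigr => t _.
  exact: laurent_coefM.
rewrite -sumrB; elim/big_ind: _ => // s _.
rewrite -sumrB; elim/big_ind: _ => // t _.
rewrite -sumrB; elim/big_ind: _ => // p _.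
exact: S_comm.
Qed.

End TraceCommutator.

(** * Gauge factors *)

Section PentagramWeights.
Variables (n : nat) (F : unitAlgType rat) (gen : generator n -> F).
Hypothesis hn : (1 < n)%N.
Hypothesis gen_unit : forall g, gen g \is a GRing.unit.

Let g s (i : int) : F := gen (s, i%:~R).

Definition face_index (m : nat) : 'Z_n := m.+1%:Z%:~R.

Lemma face_index_inj k l : (k < n)%N -> (l < n)%N ->
  face_index k = face_index l -> k = l.
Proof.
move=> ltk ltl; rewrite /face_index -!pmulrn => /(congr1 val).
rewrite /= !val_Zp_nat //.
have modS m : (m < n)%N -> (m.+1 %% n)%N = if m.+1 == n then 0%N else m.+1.
  by move=> ltm; case: eqP => [->|neq]; rewrite ?modnn ?modn_small //; lia.
by rewrite !modS //; do 2!case: eqP => //; lia.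
Qed.

Lemma generator_period s i : g s (i + n%:Z) = g s i.
Proof.
by rewrite /g intrD -[n%:Z%:~R]pmulrn pchar_Zp // addr0.
Qed.

(** The gauge factor of tl_(m+1); for [m = n] it is [Zweight]. *)
Definition strip_weight m : F :=
  \prod_(0 <= j < m) (gen (Top, face_index j) * gen (Right, face_index j)).

Lemma unit_mul (x y : F) :
  x \is a GRing.unit -> y \is a GRing.unit -> x * y \is a GRing.unit.
Proof. by move=> ux uy; rewrite unitrMr. Qed.

Lemma strip_weight0 : strip_weight 0 = 1.
Proof. by rewrite /strip_weight big_geq. Qed.

Lemma strip_weightS m : strip_weight m.+1 =
  strip_weight m * (gen (Top, face_index m) * gen (Right, face_index m)).
Proof. by rewrite /strip_weight big_nat_recr. Qed.

Lemma strip_weight_unit m : strip_weight m \is a GRing.unit.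
Proof.
elim: m => [|m IH]; first by rewrite /strip_weight big_geq ?unitr1.
by rewrite strip_weightS !unit_mul.
Qed.

Lemma zprodE m : zprod gen m.+1 = strip_weight m * gen (Top, face_index m).
Proof. by rewrite /zprod big_add1. Qed.

Lemma ZweightE : Zweight gen = strip_weight n.
Proof.
rewrite /Zweight -[X in zprod gen X](ltn_predK hn) zprodE -mulrA.
by rewrite -[in RHS](ltn_predK hn) strip_weightS /face_index (ltn_predK hn).
Qed.

Lemma Zweight_unit : Zweight gen \is a GRing.unit.
Proof. by rewrite ZweightE strip_weight_unit. Qed.

(* The gauge factors of bl_(m+1), shifted so that m >= 0. *)
Definition corner_weight (m : nat) : F := zpath gen (m%:Z - 1).

Lemma corner_weight0 : corner_weight 0 = (Zweight gen)^-1 * zprod gen n.-1.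
Proof. by []. Qed.

Lemma corner_weight1 : corner_weight 1 = (Zweight gen)^-1 * zprod gen n.
Proof. by []. Qed.

Lemma corner_weightSS m :
  corner_weight m.+2 = strip_weight m * gen (Top, face_index m).
Proof.
rewrite /corner_weight (_ : m.+2%:Z - 1 = m.+1%:Z) /zpath ?zprodE //.
Qed.

Lemma zprod_unit m : zprod gen m \is a GRing.unit.
Proof.
case: m => [|m]; first by rewrite /zprod big_geq // mul1r.
by rewrite zprodE unit_mul ?strip_weight_unit.
Qed.

Lemma corner_weight_unit m : corner_weight m \is a GRing.unit.
Proof.
case: m => [|[|m]]; last by rewrite corner_weightSS unit_mul ?strip_weight_unit.
  by rewrite corner_weight0 unit_mul ?unitrV ?Zweight_unit ?zprod_unit.
by rewrite corner_weight1 unit_mul ?unitrV ?Zweight_unit ?zprod_unit.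
Qed.

(** Identifies the inverse factors in [Xweight] as the inverse of a gauge factor. For [m] equal to 0
    or 1 the indices wrap round to the last faces and the inverse of [Zweight] cancels the full
    turn. *)
Lemma corner_strip_weight m :
  corner_weight m * g Right (m%:Z - 1) * g Top m%:Z * g Right m%:Z =
  strip_weight m.
Proof.
have ZV := mulVr Zweight_unit.
have g_last s : g s 0 = gen (s, face_index n.-1).
  by rewrite -generator_period /g /face_index; congr (gen (_, _%:~R)); lia.
have g_before_last : g Right (0 - 1) = gen (Right, face_index n.-2).
  by rewrite -generator_period /g /face_index; congr (gen (_, _%:~R)); lia.
have n1 : n.-2.+1 = n.-1 by lia.
have n2 : n.-1.+1 = n by lia.
have Zn : Zweight gen = zprod gen n * gen (Right, face_index n.-1).
  by rewrite /face_index n2.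
have Z_last : Zweight gen = zprod gen n.-1 * gen (Right, face_index n.-2)
    * gen (Top, face_index n.-1) * gen (Right, face_index n.-1).
  have := strip_weightS n.-1; rewrite {1}n2 -ZweightE => ->.
  have := strip_weightS n.-2; rewrite {1}n1 => ->.
  by have := zprodE n.-2; rewrite {1}n1 => ->; rewrite !mulrA.
case: m => [|[|m]].
- rewrite corner_weight0 g_before_last !g_last strip_weight0.
  move: (Zweight gen) (zprod gen n.-1) ZV Z_last => Z z ZV Z_last.
  by rewrite -[RHS]ZV -!mulrA; congr (_ * _); rewrite Z_last !mulrA.
- rewrite corner_weight1 subrr g_last strip_weightS strip_weight0 mul1r.
  move: (Zweight gen) (zprod gen n) ZV Zn => Z z ZV Zn.
  by rewrite -[_^-1 * _ * _]mulrA -Zn ZV mul1r.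
rewrite corner_weightSS strip_weightS -mulrA -mulrA mulrA.
rewrite (_ : m.+2%:Z - 1 = m.+1%:Z); last by lia.
by rewrite strip_weightS !mulrA.
Qed.

Lemma Xweight_gauge m :
  Xweight gen m.+1 * strip_weight m = corner_weight m * gen (Left, face_index m).
Proof.
rewrite -corner_strip_weight /Xweight /corner_weight.
rewrite (_ : m.+1%:Z - 2 = m%:Z - 1); last by lia.
rewrite (_ : m.+1%:Z - 1 = m%:Z); last by lia.
rewrite !mulrA divrK ?corner_weight_unit // divrK // divrK // divrK //.
Qed.

Lemma Yweight_gauge m :
  Yweight gen m.+1 * strip_weight m.+1 =
  corner_weight m * gen (Bottom, face_index m).
Proof.
rewrite strip_weightS -corner_strip_weight /Yweight /corner_weight.
rewrite (_ : m.+1%:Z - 2 = m%:Z - 1); last by lia.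
rewrite (_ : m.+1%:Z - 1 = m%:Z); last by lia.
rewrite !mulrA divrK ?corner_weight_unit // divrK // divrK // divrK //.
by rewrite divrK // divrK.
Qed.

End PentagramWeights.

Section SubalgebraCommutators.
Variables (K : fieldType) (A : algType K).

Lemma generated_subalgebra_gen (G : A -> Prop) x :
  G x -> x \in generated_subalgebra G.
Proof. by move=> Gx; apply/asboolP => S _; apply. Qed.

Lemma generated_subalgebra_subring (G : A -> Prop) :
  subring_closed (generated_subalgebra G).
Proof.
split=> [|x y /asboolP Sx /asboolP Sy|x y /asboolP Sx /asboolP Sy];
  apply/asboolP => S subS SG; have [S1 Slin SM] := subS => //.
- by rewrite addrC -scaleN1r; apply: Slin; [apply: Sy | apply: Sx].
by apply: SM; [apply: Sx | apply: Sy].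
Qed.

Lemma natural_bracket_eq0 (db : A -> A -> tensor A A) (L : {pred A}) x y :
  tensor_mult (db x y) \in commutator_space L -> natural_bracket db L x y = 0.
Proof.
move=> xyL.
have xy0 : natural_bracket db L x y = \pi_(natural L)%qT 0.
  by apply/eqP; rewrite -Quotient.idealrBE subr0.
by rewrite xy0 raddf0.
Qed.

End SubalgebraCommutators.

Lemma free_generator_neq0 (K : fieldType) (I : choiceType) (i : I) :
  free_generator K i != 0.
Proof. by rewrite /free_generator monalgU_eq0 oner_eq0. Qed.

(** * Flow of the gauge factors at the rim *)

Section CornerFlow.
Variables (F : unitRingType) (h : F -> F).
Hypothesis hM : forall x y, h (x * y) = h x * y + x * h y.

(** [Z] and [Z * x] start at the same vertex, so the terms with [p] cancel. *)
Lemma quotient_flow (Z x e p q : F) : Z \is a GRing.unit ->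
  h Z *+ 2 = Z * q - p * Z -> h (Z * x) *+ 2 = Z * x * e - p * (Z * x) ->
  h x *+ 2 = x * e - q * x.
Proof.
move=> uZ hZ; rewrite hM mulrnDl -(mulrnAl (h Z)) -(mulrnAr Z) hZ => hZx.
apply: (mulrI uZ); apply: (@addrI _ ((Z * q - p * Z) * x)); rewrite hZx.
by rewrite mulrBl mulrBr !mulrA [RHS]addrC addrA subrK.
Qed.

Variables (n : nat) (a b c d : nat -> F) (T P S : nat -> 'M[laurent F]_3).
Hypothesis hn : (1 < n)%N.
Hypothesis TE : forall m, T m = transfer (a m) (b m) (c m) (d m).
Hypothesis TS : forall m, (m < n)%N -> T m * S m = P m.
Hypothesis ST : forall m, S m * T m = P m.+1.
Hypothesis flow : forall m, (m < n)%N ->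
  edge_flow h (a m) (b m) (c m) (d m)
    (S m strand1 strand1)@_0 (S m strand1 strand2)@_0
    (S m strand3 strand1)@_1 (S m strand3 strand2)@_1.

Let w m := \prod_(0 <= j < m) (d j * c j).
Let Q := P n.
Hypothesis P_periodic : P 0 = Q.

Variables (Z x y : F).
Hypotheses (uZ : Z \is a GRing.unit) (ux : x \is a GRing.unit)
  (uy : y \is a GRing.unit).
Hypothesis ZE : Z = w n.
Hypothesis Zx : Z * x = w n.-2 * d n.-2.
Hypothesis Zy : Z * y = w n.-1 * d n.-1.

Let wS m : w m.+1 = w m * (d m * c m).
Proof. by rewrite /w big_nat_recr. Qed.

Let n1 : n.-2.+1 = n.-1. Proof. by lia. Qed.
Let n2 : n.-1.+1 = n. Proof. by lia. Qed.

Let wn : w n = w n.-1 * (d n.-1 * c n.-1).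
Proof. by rewrite -[in LHS]n2 wS. Qed.

Let wn1 : w n.-1 = w n.-2 * (d n.-2 * c n.-2).
Proof. by rewrite -[in LHS]n1 wS. Qed.

Let Z_flow : h Z *+ 2 = Z * (Q strand1 strand1)@_0 - (Q strand1 strand1)@_0 * Z.
Proof.
have := right_sides_flow hM TE TS ST flow (leqnn n).
by rewrite -/(w n) -ZE P_periodic.
Qed.

Let yc : y * c n.-1 = 1.
Proof. by apply: (mulrI uZ); rewrite mulrA Zy mulr1 ZE wn !mulrA. Qed.

Let xcd : x * (c n.-2 * d n.-1) = y.
Proof. by apply: (mulrI uZ); rewrite !mulrA Zx Zy wn1 !mulrA. Qed.

(** With gauge factors [g = (1, x, y)], every term on the right, here and in the next lemma, has the
    form [g_s * Q_st / g_t]: it is a coefficient of the conjugate of [Q], which is what will put it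
    in L. The factor [c n.-1] is absorbed because it is inverse to [y]. *)
Lemma last_corner_flow :
  h y *+ 2 / y = ((Q strand1 strand3)@_(-1) / y) *+ 2
    + y * (Q strand3 strand3)@_0 / y - (Q strand1 strand1)@_0.
Proof.
have lt_n1 : (n.-1 < n)%N by lia.
have := top_sides_flow hM TE TS ST flow lt_n1.
rewrite n2 -/(w n.-1) -Zy P_periodic => /(quotient_flow uZ Z_flow) ->.
by rewrite mulrBl mulrK // mulrDr mulrDl mulrnAr mulrnAl (mulrA y) yc mul1r.
Qed.

Lemma before_last_corner_flow :
  h x *+ 2 / x =
    ((Q strand1 strand2)@_(-1) / x + y * (Q strand3 strand2)@_0 / x) *+ 2
    + x * (Q strand2 strand2)@_0 / x - (Q strand1 strand1)@_0.
Proof.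
have lt_n2 : (n.-2 < n)%N by lia.
have lt_n1 : (n.-1 < n)%N by lia.
have := top_sides_flow hM TE TS ST flow lt_n2.
rewrite n1 -/(w n.-2) -Zx P_periodic => /(quotient_flow uZ Z_flow) ->.
(* The flow comes out in terms of [P n.-1]; this relation carries it across the last face to the
   rim. *)
have TQ : T n.-1 * Q = P n.-1 * T n.-1 by rewrite /Q -[in LHS]n2 -ST mulrA (TS lt_n1).
have [_ <- _] := transfer_mulr_coef (a n.-1) (b n.-1) (c n.-1) (d n.-1) (P n.-1) strand1 (-1).
have [_ <- _] := transfer_mulr_coef (a n.-1) (b n.-1) (c n.-1) (d n.-1) (P n.-1) strand3 0.
rewrite -TE -TQ TE.
have [-> _ _] := transfer_mull_coef (a n.-1) (b n.-1) (c n.-1) (d n.-1) Q strand2 (-1).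
have [_ _ ->] := transfer_mull_coef (a n.-1) (b n.-1) (c n.-1) (d n.-1) Q strand2 0.
rewrite mulrBl mulrK // mulrDr mulrDl mulrnAr mulrnAl addNr; congr (_ *+ 2 + _ - _).
rewrite -mulrDl; congr (_ / x).
by rewrite !mulrDr !mulrA -(mulrA x) xcd yc mul1r.
Qed.

End CornerFlow.

Lemma conj_power (R : pzRingType) (g g' x y : R) i :
  g * g' = 1 -> g' * g = 1 -> y * g = g * x -> y ^+ i = g * x ^+ i * g'.
Proof.
move=> gg' g'g yg; elim: i => [|i IH]; first by rewrite mulr1.
by rewrite exprS IH !mulrA yg -(mulrA g x) -exprS.
Qed.

Section ScalarMatrices.
Variable F : nzRingType.
Implicit Types (A : 'M[laurent F]_3) (x : laurent F).

Lemma mul_mx_scalarE A x s t : (A * x%:M) s t = A s t * x.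
Proof.
by rewrite -[A * _]/(A *m _) -diag_const_mx mul_mx_diag !mxE.
Qed.

Lemma mul_scalar_mxE A x s t : (x%:M * A) s t = x * A s t.
Proof.
by rewrite -[_ * A]/(_ *m A) -diag_const_mx mul_diag_mx !mxE.
Qed.

Lemma lambda_comm A k : GRing.comm A (laurent_monomial 1 k)%:M.
Proof.
apply/matrixP => s t; rewrite mul_mx_scalarE mul_scalar_mxE.
exact/esym/laurent_monomial_central.
Qed.

Lemma trace_lambda A e k :
  (\tr (A * (laurent_monomial 1 e)%:M))@_k = (\tr A)@_(k - e).
Proof.
rewrite !laurent_coef_sum; apply: eq_bigr => s _.
by rewrite mul_mx_scalarE laurent_coefMU mulr1.
Qed.

Lemma lambdaX e i : ((laurent_monomial 1 e)%:M : 'M[laurent F]_3) ^+ i =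
  (laurent_monomial 1 (e * i%:Z))%:M.
Proof.
elim: i => [|i IH]; first by rewrite mulr0.
rewrite exprS IH -[_%:M * _]/(_ *m _) -scalar_mxM laurent_monomialM mulr1.
by congr (laurent_monomial _ _)%:M; lia.
Qed.

Lemma scalar_lambda (a : F) e :
  (laurent_monomial a 0)%:M * (laurent_monomial 1 e)%:M =
  (laurent_monomial a e)%:M :> 'M[laurent F]_3.
Proof.
by rewrite -[_%:M * _]/(_ *m _) -scalar_mxM laurent_monomialM mulr1 add0r.
Qed.

Lemma trace_lambdaX A e i k :
  (\tr ((A * (laurent_monomial 1 e)%:M) ^+ i))@_k =
  (\tr (A ^+ i))@_(k - e * i%:Z).
Proof.
have lambda_c := lambda_comm A e; have := lambdaX e i.
move: (laurent_monomial 1 e)%:M lambda_c => L Lc LX.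
by rewrite (exprMn_comm i Lc) LX trace_lambda.
Qed.

Lemma laurent_form_coef (V : zmodType) (psi : F -> F -> V) (f : laurent F) k :
  cyclic_form psi -> laurent_form psi f (laurent_monomial 1 (- k)) = psi f@_k 1.
Proof.
move=> psi_cyc; elim/laurent_ind: f => [|f g IHf IHg|x p].
- by rewrite (cyclic0l (laurent_form_cyclic psi_cyc)) laurent_coef0 (cyclic0l psi_cyc).
- by rewrite (laurent_formDl psi_cyc) IHf IHg laurent_coefD (cyclicDl psi_cyc).
rewrite (laurent_formU psi_cyc) !mcoeffU eqr_opp eq_sym; case: eqP => _ //.
by rewrite (cyclic0l psi_cyc) (cyclic0r psi_cyc).
Qed.

End ScalarMatrices.

Lemma cyclic_mulrn_r (A : pzRingType) (V : zmodType) (psi : A -> A -> V) x r m :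
  cyclic_form psi -> psi x (r *+ m) = psi x r *+ m.
Proof.
move=> psi_cyc; elim: m => [|m IH]; first by rewrite !mulr0n (cyclic0r psi_cyc).
by rewrite !mulrS (cyclicDr psi_cyc) IH.
Qed.

(** * The monodromy and its gauge transform *)

Section Main.
Variables (n : nat) (F : unitAlgType rat) (gen : generator n -> F).
Hypothesis hn : (1 < n)%N.
Hypothesis gen_unit : forall g, gen g \is a GRing.unit.
Variable db : F -> F -> tensor F F.
Hypothesis hdb : network_bracket gen db.

Let Z := Zweight gen.
Let w := strip_weight gen.
Let x := corner_weight gen.

Definition face_transfer m : 'M[laurent F]_3 :=
  transfer (gen (Left, face_index n m)) (gen (Bottom, face_index n m))
    (gen (Right, face_index n m)) (gen (Top, face_index n m)).

Definition gauged_transfer m : 'M[laurent F]_3 :=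
  transfer (Xweight gen m.+1) (Yweight gen m.+1) 1 1.

Definition monodromy : 'M[laurent F]_3 := \prod_(0 <= j < n) face_transfer j.

(** The boundary measurement matrix without its scalar power of lambda. *)
Definition gauged_monodromy : 'M[laurent F]_3 :=
  (\prod_(0 <= j < n) gauged_transfer j) * (laurent_monomial Z 0)%:M.

(** The gauge factors of tl_1, bl_1, bl_2, the vertices entered from the sources. *)
Definition rim_weight := strand_fun 1 (x 0) (x 1).
Definition rim_gauge := gauge rim_weight.
Definition rim_gauge_inv := gauge (fun s => (rim_weight s)^-1).

Lemma rim_weight_unit s : rim_weight s \is a GRing.unit.
Proof.
by case: (strandP s) => ->; rewrite /rim_weight /strand_fun /= ?unitr1
  ?corner_weight_unit.
Qed.

Lemma rim_gaugeV : rim_gauge * rim_gauge_inv = 1.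
Proof. by apply: gaugeV => s; rewrite mulrV ?rim_weight_unit. Qed.

Lemma rim_gaugeVl : rim_gauge_inv * rim_gauge = 1.
Proof. by apply: gaugeV => s; rewrite mulVr ?rim_weight_unit. Qed.

Lemma Z_corner0 : Z * x 0 = w n.-2 * gen (Top, face_index n n.-2).
Proof.
rewrite /x corner_weight0 mulrA mulrV ?Zweight_unit // mul1r.
by have := zprodE gen n.-2; rewrite {1}(_ : n.-2.+1 = n.-1) //; lia.
Qed.

Lemma Z_corner1 : Z * x 1 = w n.-1 * gen (Top, face_index n n.-1).
Proof.
rewrite /x corner_weight1 mulrA mulrV ?Zweight_unit // mul1r.
by have := zprodE gen n.-1; rewrite {1}(_ : n.-1.+1 = n) //; lia.
Qed.

Lemma gauged_monodromyE : gauged_monodromy * rim_gauge = rim_gauge * monodromy.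
Proof.
pose G m := gauge (strand_fun (w m) (x m) (x m.+1)).
have step m : (m < n)%N -> gauged_transfer m * G m.+1 = G m * face_transfer m.
  move=> ltmn; apply: gauge_transfer.
  - exact: Xweight_gauge.
  - exact: Yweight_gauge.
  - exact: strip_weightS.
  exact: corner_weightSS.
have G0 : G 0 = rim_gauge.
  by rewrite /G /rim_gauge /rim_weight /w strip_weight0.
(* After a full turn the gauge factors are multiplied by [Z] on the left, which the weight of the
   arrows into the sinks makes up for. *)
have Gn : G n = (laurent_monomial Z 0)%:M * rim_gauge.
  have xn : x n = Z * x 0.
    rewrite Z_corner0 -corner_weightSS; congr (corner_weight gen _); lia.
  have xn1 : x n.+1 = Z * x 1.
    rewrite Z_corner1 -corner_weightSS; congr (corner_weight gen _); lia.
  apply/matrixP => s t; rewrite mul_scalar_mxE !mxE xn xn1 /w -ZweightE //.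
  case: eqP => _; rewrite ?mulr0n ?mulr0 // !mulr1n laurent_monomialM addr0.
  congr (laurent_monomial _ _).
  by case: (strandP s) => ->; rewrite /rim_weight /strand_fun /= ?mulr1.
by rewrite /gauged_monodromy -mulrA -Gn (prod_gauge step) G0.
Qed.

Lemma t_trace i k : t_ gen i k =
  (\tr (gauged_monodromy ^+ i))@_(k - (n.+1 %/ 3)%:Z * i%:Z).
Proof.
have bmE : boundary_measurement n (fun i : nat => Xweight gen i)
      (fun i : nat => Yweight gen i) Z =
    gauged_monodromy * (laurent_monomial 1 (n.+1 %/ 3)%:Z)%:M.
  rewrite (boundary_measurement_prod _ _ _ hn) /gauged_monodromy -mulrA.
  by rewrite scalar_lambda.
rewrite /t_ /t_coef bmE; exact: trace_lambdaX.
Qed.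

(** Since lambda^-k is central, the trace may be taken of the power of the ungauged monodromy; [C]
    then collects the other [i] factors and the multiplicity [i.+1]. *)
Lemma trace_bracket i k y :
  let C := (monodromy ^+ i * (laurent_monomial 1 (- k))%:M) *+ i.+1 in
  tensor_mult (db (\tr (gauged_monodromy ^+ i.+1))@_k y) =
  \sum_(0 <= m < n)
     matrix_form (laurent_form (loop_insertion db y))
       (face_transfer m) (remainder face_transfer n C m).
Proof.
move=> C; have psi_cyc := loop_insertion_cyclic hdb.1 y.
have form_cyc := laurent_form_cyclic psi_cyc.
have mform_cyc := matrix_form_cyclic 2 form_cyc.
rewrite tensor_mult_db -(laurent_form_coef _ _ psi_cyc).
rewrite -(matrix_form_scalar form_cyc).
have -> : gauged_monodromy ^+ i.+1 =
    rim_gauge * monodromy ^+ i.+1 * rim_gauge_inv.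
  by apply: conj_power; [exact: rim_gaugeV | exact: rim_gaugeVl | exact: gauged_monodromyE].
rewrite (cyclic_conj mform_cyc rim_gaugeVl);
  [| exact: lambda_comm | exact: lambda_comm | exact: lambda_comm].
rewrite (cyclicX mform_cyc); last exact: lambda_comm.
rewrite -(cyclic_mulrn_r _ _ _ mform_cyc) -/C (cyclic_prod mform_cyc).
reflexivity.
Qed.

End Main.

(** * Involutivity *)

Lemma trace_map_derivation (F : nzRingType) (h : F -> F) (A : 'M[laurent F]_3) l :
  {morph h : x y / x + y} ->
  (\tr (map_derivation h A *+ 2))@_l = h (\tr A)@_l *+ 2.
Proof.
move=> hD; rewrite mulr2n mxtraceD laurent_coefD -mulr2n; congr (_ *+ 2).
rewrite !laurent_coef_sum (derivation_sum hD); apply: eq_bigr => s _.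
by rewrite map_derivation_coef // derivation0.
Qed.

Lemma rotation0 (R : pzRingType) (T : nat -> R) n C :
  rotation T n C 0 = (\prod_(0 <= j < n) T j) * C.
Proof. by rewrite /rotation [X in _ * X]big_geq // mulr1. Qed.

Lemma rotationn (R : pzRingType) (T : nat -> R) n C :
  rotation T n C n = C * \prod_(0 <= j < n) T j.
Proof. by rewrite /rotation (@big_geq _ _ _ n n) // mul1r. Qed.

Lemma conj_scaled (R : pzRingType) (g g' x y z : R) i m :
  g * g' = 1 -> g' * g = 1 -> y * g = g * x -> GRing.comm g' z ->
  g * (x * ((x ^+ i * z) *+ m)) * g' = (y ^+ i.+1 * z) *+ m.
Proof.
move=> gg' g'g yg cz; rewrite (conj_power i.+1 gg' g'g yg).
by rewrite !mulrnAr !mulrnAl (mulrA x) -exprS -!mulrA cz.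
Qed.

Lemma comm_scaled (R : pzRingType) (x z : R) i m :
  GRing.comm x z -> GRing.comm x ((x ^+ i * z) *+ m).
Proof. by move=> cz; apply/commrMn/commrM => //; apply: commrX. Qed.

Section Involution.
Variables (n : nat) (F : unitAlgType rat) (gen : generator n -> F).
Hypothesis hn : (1 < n)%N.
Hypothesis gen_unit : forall g, gen g \is a GRing.unit.
Variable db : F -> F -> tensor F F.
Hypothesis hdb : network_bracket gen db.

Let L := Lbullet gen.
Let L_subring : subring_closed L := generated_subalgebra_subring _.
Let L1 : 1 \in L. Proof. by case: L_subring. Qed.
Let LB : {in L &, forall x y, x - y \in L}. Proof. by case: L_subring. Qed.
Let L0 : 0 \in L. Proof. by rewrite -(subrr 1) LB. Qed.
Let LD : {in L &, forall x y, x + y \in L}.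
Proof.
by move=> x y Lx Ly; rewrite -[y]opprK -[- y]sub0r LB ?LB.
Qed.

Lemma coef_in_gauged_monodromy : coef_in L (gauged_monodromy gen).
Proof.
apply: coef_inM => //; last first.
  by apply: coef_in_scalar => //; apply: generated_subalgebra_gen; left.
rewrite big_nat; elim/big_ind: _ => [|A B|m /andP[_ ltmn]].
- exact: coef_in1.
- exact: coef_inM.
apply: coef_in_transfer => //; apply: generated_subalgebra_gen; right; right;
  exists m.+1 => //.
  by constructor 1.
by constructor 3.
Qed.

Lemma coef_in_gauge_flow (h : F -> F) (g : 'I_3 -> F) : h 0 = 0 ->
  (forall s, h (g s) *+ 2 / g s \in L) ->
  coef_in L (map_derivation h (gauge g) *+ 2 * gauge (fun s => (g s)^-1)).
Proof.
move=> h0 hg s r e; rewrite mul_gaugeE laurent_coefMU subr0 mulr2n mxE.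
rewrite laurent_coefD map_derivation_coef // !mxE.
case: eqP => [<-|_]; rewrite ?mulr0n ?mulr1n; last first.
  by rewrite laurent_coef0 h0 addr0 mul0r.
rewrite mcoeffU; case: eqP => _ /=; last by rewrite h0 addr0 mul0r.
by rewrite -mulr2n; apply: hg.
Qed.

Lemma t_bracket_in i j k l :
  tensor_mult (db (t_ gen i.+1 k) (t_ gen j l)) \in commutator_space L.
Proof.
rewrite !(t_trace gen hn); set k' := k - _; set l' := l - _.
pose C := (monodromy gen ^+ i * (laurent_monomial 1 (- k'))%:M) *+ i.+1.
have hx := trace_bracket hn gen_unit hdb i k'.
set t := (\tr (gauged_monodromy gen ^+ i.+1))@_k' in hx *.
pose h y := tensor_mult (db t y).
have hD : {morph h : x y / x + y}.
  by move=> x y; rewrite /h (db_addr hdb.1) tensor_multD.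
have hM x y : h (x * y) = h x * y + x * h y by apply: bracket_derivation hdb.1 _ _ _.
have flow := network_flow hdb (face_index_inj hn) hx.
rewrite -/C in flow.
have TS m (ltmn : (m < n)%N) := mul_remainder (face_transfer gen) C ltmn.
have ST m := remainder_mul (face_transfer gen) n C m.
have P0 : rotation (face_transfer gen) n C 0 = monodromy gen * C :=
  rotation0 (face_transfer gen) n C.
have Pn : rotation (face_transfer gen) n C n = C * monodromy gen :=
  rotationn (face_transfer gen) n C.
have TE m : face_transfer gen m = transfer (gen (Left, face_index n m))
    (gen (Bottom, face_index n m)) (gen (Right, face_index n m))
    (gen (Top, face_index n m)) by [].
have comm_C : GRing.comm (monodromy gen) C.
  exact: comm_scaled (lambda_comm _ _).
move: (rotation (face_transfer gen) n C) (remainder (face_transfer gen) n C)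
  P0 Pn TS ST flow => P S P0 Pn TS ST flow.
(* This makes the equation for the full product a commutator. *)
have P_periodic : P 0 = P n by rewrite P0 Pn; exact: comm_C.
have conj_P := conj_scaled i i.+1 (rim_gaugeV hn gen_unit) (rim_gaugeVl hn gen_unit)
  (gauged_monodromyE hn gen_unit) (lambda_comm (rim_gauge_inv gen) (- k')).
have {}conj_P : rim_gauge gen * P n * rim_gauge_inv gen = _ :=
  etrans (congr1 (fun A => rim_gauge gen * A * rim_gauge_inv gen)
    (etrans (esym P_periodic) P0)) conj_P.
have lax := prefix_lax hD hM TE TS ST flow (leqnn n).
rewrite P_periodic -/(monodromy gen) in lax.
have uZ := Zweight_unit hn gen_unit.
have corner0 := before_last_corner_flow hM hn TE TS ST flow P_periodic uZ
  (corner_weight_unit hn gen_unit 0) (corner_weight_unit hn gen_unit 1)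
  (ZweightE gen hn) (Z_corner0 hn gen_unit) (Z_corner1 hn gen_unit).
have corner1 := last_corner_flow hM hn TE TS ST flow P_periodic uZ
  (corner_weight_unit hn gen_unit 0) (corner_weight_unit hn gen_unit 1)
  (ZweightE gen hn) (Z_corner1 hn gen_unit).
move: (P n) conj_P lax corner0 corner1 => Q conj_Q lax corner0 corner1.
(* By [conj_P] this conjugate is a multiple of a power of the gauged monodromy times lambda^-k'. *)
have conj_Q_in : coef_in L (rim_gauge gen * Q * rim_gauge_inv gen).
  rewrite conj_Q; apply: coef_in_mulrn => //; apply: coef_inM => //.
    exact: (coef_inX L_subring i.+1 coef_in_gauged_monodromy).
  exact: coef_in_scalar.
have Q_in s r e : rim_weight gen s * (Q s r)@_e / rim_weight gen r \in L.
  by have := conj_Q_in s r e; rewrite gauge_coef.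
have Q11 := Q_in strand1 strand1 0; have Q12 := Q_in strand1 strand2 (-1).
have Q13 := Q_in strand1 strand3 (-1); have Q22 := Q_in strand2 strand2 0.
have Q32 := Q_in strand3 strand2 0; have Q33 := Q_in strand3 strand3 0.
rewrite {1 2}/rim_weight /strand_fun /= !(mul1r, invr1, mulr1) in Q11 Q12 Q13 Q22 Q32 Q33.
have rim_in s : h (rim_weight gen s) *+ 2 / rim_weight gen s \in L.
  case: (strandP s) => ->; rewrite /rim_weight /strand_fun /=.
  - by rewrite (derivation1 hM) mul0rn mul0r.
  - by rewrite corner0 LB // LD // mulr2n LD // LD.
  by rewrite corner1 LB // LD // mulr2n LD.
have laxB := lax_conj (map_derivationM hD hM) (rim_gaugeV hn gen_unit)
  (rim_gaugeVl hn gen_unit) (gauged_monodromyE hn gen_unit) lax.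
have laxBj := laxX (map_derivationM hD hM) laxB j.
have M_in : coef_in L (rim_gauge gen * rmatrix Q * rim_gauge_inv gen
    + map_derivation h (rim_gauge gen) *+ 2 * rim_gauge_inv gen).
  apply: (coef_inD L_subring); last exact: coef_in_gauge_flow (derivation0 hD) rim_in.
  have -> : rim_gauge gen * rmatrix Q * rim_gauge_inv gen =
      rmatrix (rim_gauge gen * Q * rim_gauge_inv gen) := rmatrix_gauge _ _ Q.
  exact: (coef_in_rmatrix L_subring conj_Q_in).
move: laxBj; move: (_ + _) M_in => M M_in laxBj.
apply/asboolP => V [V0 V_lin] V_comm.
have V_zmod : zmod_closed V.
  by split=> // u v uV vV; rewrite addrC -scaleN1r; apply: V_lin.
have : (\tr (map_derivation h (gauged_monodromy gen ^+ j) *+ 2))@_l' \in V.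
  rewrite laxBj; apply: (mxtrace_commutator_in V_zmod V_comm) M_in _.
  exact: (coef_inX L_subring j coef_in_gauged_monodromy).
rewrite (trace_map_derivation _ _ hD) => hV.
(* The doubling is undone here, [V] being a rational subspace. *)
have := V_lin 2^-1 _ _ hV V0.
by rewrite addr0 -scaler_nat scalerA mulVf // scale1r.
Qed.

End Involution.

Theorem theorem14 (n : nat) (hn : (1 < n)%N) (F : unitAlgType rat)
    (phi : {lrmorphism free_algebra rat (generator n) -> F})
    (hphi : universal_field_of_fractions phi)
    (gen : generator n -> F)
    (hgen : forall g, gen g = phi (free_generator rat g))
    (db : F -> F -> tensor F F) (hdb : network_bracket gen db)
    (i j : nat) (hi : (0 < i)%N) (hj : (0 < j)%N) (k l : int) :
  natural_bracket db (Lbullet gen) (t_ gen i k) (t_ gen j l) = 0.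
Proof.
case: i hi => // i _; apply/natural_bracket_eq0/t_bracket_in => // g.
(* The images of the generators are non-zero by injectivity, hence invertible in the skew field. *)
have [phi_inj [divF _] _] := hphi; rewrite hgen; apply: divF.
by rewrite -(raddf0 phi) (inj_eq phi_inj) free_generator_neq0.
Qed.
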